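(* Let $R=N\oplus Q$ be a finite-dimensional complex solvable Leibniz algebra with nilradical $N$, where $Q$ is a vector subspace complementary to $N$. Suppose $\dim Q=\dim(N/N^2)=k+p$ and $N=\bigoplus_{t=1}^{s}N_t\oplus\mathbb{C}^p$, where each $N_t$ is a non-split non-abelian ideal of $N$ with $\dim N_t=n_t$, and $\mathbb{C}^p$ denotes a $p$-dimensional abelian ideal. Then: (1) $R$ admits a basis $\{e_1^t,\dots,e_{k_t^1}^t,e_{k_t^1+1}^t,\dots,e_{k_t}^t,e_{k_t+1}^t,\dots,e_{n_t}^t,x_1^t,\dots,x_{k_t}^t : 1\le t\le s\}\cup\{f_1,\dots,f_p,y_1,\dots,y_p\}$, adapted to $N$ in the sense of the context, and there exist $b_1,\dots,b_p\in\{0,1\}$ such that the table of multiplications of $R$ has the form (all products of basis elements not listed being zero) $$R_1(b_1,\dots,b_p):\ \left\{\begin{array}{ll} [e_i^t,e_j^t]=\sum\limits_{r=k_t+1}^{n_t}\gamma_{i,j}^{t,r}e_r^t, & 1\le i,j\le n_t,\ 1\le t\le s,\\ {[e_i^t,x_i^t]}=e_i^t, & 1\le i\le k_t,\ 1\le t\le s,\\ {[x_i^t,e_i^t]}=-e_i^t, & 1\le i\le k_t^1,\ 1\le t\le s,\\ {[e_i^t,x_j^t]}=\alpha_{i,j}^te_i^t, & k_t+1\le i\le n_t,\ 1\le j\le k_t,\ 1\le t\le s,\\ {[x_j^t,e_i^t]}=\sum\limits_{l=1}^{q}\beta_{t,j,i}^{i_l}e_{i_l}^t, & k_t+1\le i\le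 n_t,\ 1\le j\le k_t,\ 1\le t\le s,\\ {[f_i,y_i]}=f_i, & 1\le i\le p,\\ {[y_i,f_i]}=(b_i-1)f_i, & 1\le i\le p, \end{array}\right.$$ where $\gamma_{i,j}^{t,r},\beta_{t,j,i}^{i_l}\in\mathbb{C}$, $\alpha_{i,j}^t$ is the number of occurrences of the generator $e_j^t$ in the non-generator basis element $e_i^t$, and, for each $t,i$, $\{e_{i_1}^t,\dots,e_{i_q}^t\}$ is the set of all non-generator basis elements of $N_t$ having the same structure as $e_i^t$. (2) $R$ has the form $R=\bigoplus_{t=1}^{s}R_t\oplus R(\mathbb{C}^p)$ with $R_t=N_t\oplus Q_t$, where $N_t$ is the nilradical of $R_t$ and $Q_t$ is a subspace complementary to $N_t$ in $R_t$, and $R(\mathbb{C}^p)$ is the solvable algebra with nilradical $\mathbb{C}^p$ spanned by $f_1,\dots,f_p,y_1,\dots,y_p$.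
   Context: All algebras and vector spaces are finite-dimensional over $\mathbb{C}$. A (right) Leibniz algebra is a vector space $L$ with a bilinear bracket satisfying $[[x,y],z]=[[x,z],y]+[x,[y,z]]$ for all $x,y,z\in L$. Put $L^1=L$, $L^{m+1}=[L^m,L]$ and $L^{[1]}=L$, $L^{[m+1]}=[L^{[m]},L^{[m]}]$; $L$ is nilpotent (resp. solvable) if $L^m=0$ (resp. $L^{[m]}=0$) for some $m$. The nilradical is the maximal nilpotent ideal. The right annihilator is $Ann_r(L)=\{x\in L : [y,x]=0\ \text{for all } y\in L\}$. An algebra is non-split if it is not a direct sum of two nonzero ideals. Adapted basis: for each $t$, $\{e_1^t,\dots,e_{n_t}^t\}$ is a basis of $N_t$; $k_t=\dim(N_t/N_t^2)$ (so $k=\sum_t k_t$) and $e_1^t,\dots,e_{k_t}^t$ are generators of $N_t$ (their classes form a basis of $N_t/N_t^2$), ordered so that $\{e_1^t,\dots,e_{k_t^1}^t\}\cap Ann_r(N_t)=\emptyset$ and $\{e_{k_t^1+1}^t,\dots,e_{k_t}^t\}\subset Ann_r(N_t)$; each non-generator basis element $e_i^t$, $k_t+1\le i\le n_t$, lies in $N_t^2$ and is an iterated bracket $[[\cdots[[e_{i_1}^t,e_{i_2}^t],e_{i_3}^t],\cdots],e_{i_m}^t]$, $m\ge2$, of generators of $N_t$; $f_1,\dots,f_p$ is a basis of the abelian summand $\mathbb{C}^p$; and the elements $x_j^t$ ($1\le t\le s$, $1\le j\le k_t$) together with $y_1,\dots,y_p$ span a complement of $N$ in $R$. The number $\alpha_{i,j}^t$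 is the number of indices $l$ with $i_l=j$ in the word expressing $e_i^t$. Two non-generator basis elements $e_i^t,e_m^t$ have the same structure if $\alpha_{i,r}^t=\alpha_{m,r}^t$ for all $1\le r\le k_t$ (so $q$ depends on $t,i$).
   Formalization: In the conclusion the summands N_t and C^p are replaced by their images under some automorphism of N; with the summands exactly as given the claim fails, e.g. for N = ⟨e1,e2,e3,f⟩ with [e1,e2]=e3, N_1 = ⟨e1+f,e2,e3⟩ and abelian summand ⟨f⟩. *)

(* Defs.v *)
From HB Require Import structures.
From mathcomp Require Import all_boot all_order all_algebra.
From mathcomp Require Export reals.
From mathcomp.real_closed Require Export complex.

Set Implicit Arguments.
Unset Strict Implicit.
Unset Printing Implicit Defensive.

Import GRing.Theory.
Local Open Scope ring_scope.

Section LeibnizAlgebra.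
Variables (F : fieldType) (L : vectType F).
Implicit Types (br : L -> L -> L) (U V A I : {vspace L}).

Definition right_leibniz br : Prop :=
  forall x y z, br (br x y) z = br (br x z) y + br x (br y z).

(* [U, V] is the linear span of the brackets; see [bracketvP]. *)
Definition bracketv br U V : {vspace L} :=
  <<[seq br u v | u <- vbasis U, v <- vbasis V]>>%VS.

(* The series are indexed from 0: [lower_central br U m] is U^{m+1} and
   [derived_series br U m] is U^{[m+1]}. *)
Fixpoint lower_central br U (m : nat) : {vspace L} :=
  if m is m'.+1 then bracketv br (lower_central br U m') U else U.

Fixpoint derived_series br U (m : nat) : {vspace L} :=
  if m is m'.+1
  then bracketv br (derived_series br U m') (derived_series br U m') else U.

Definition nilpotent_alg br U : Prop := exists m, lower_central br U m = 0%VS.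
Definition solvable_alg br U : Prop := exists m, derived_series br U m = 0%VS.
Definition abelian_alg br U : Prop := bracketv br U U = 0%VS.

(* I is a two-sided ideal of the subalgebra A. *)
Definition ideal br A I : Prop :=
  [/\ (I <= A)%VS, (bracketv br I A <= I)%VS & (bracketv br A I <= I)%VS].

Definition nilradical br A I : Prop :=
  [/\ ideal br A I, nilpotent_alg br I
    & forall J, ideal br A J -> nilpotent_alg br J -> (J <= I)%VS].

Definition split_alg br U : Prop :=
  exists I J, [/\ ideal br U I, ideal br U J, I != 0%VS, J != 0%VS
                & (I + J)%VS = U /\ (I :&: J)%VS = 0%VS].

Definition annr br U (x : L) : Prop :=
  x \in U /\ forall y, y \in U -> br y x = 0.

(* dim (U / U^2); U^2 is contained in U when U is a subalgebra. *)
Definition dim_abel br U : nat := (\dim U - \dim (bracketv br U U))%N.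

(* The classes of the elements of X form a basis of U / V. *)
Definition basis_mod U V (X : seq L) : Prop :=
  [/\ free X, (<<X>> + V)%VS = U & (<<X>> :&: V)%VS = 0%VS].

Definition automorphism br U (phi : 'End(L)) : Prop :=
  (phi @: U)%VS = U /\ {in U &, forall u v, phi (br u v) = br (phi u) (phi v)}.

(* [[..[g i1, g i2], ..], g im] for the word i1 i2 .. im *)
Definition iter_bracket br (g : nat -> L) (w : seq nat) : L :=
  if w is i :: w' then foldl (fun u j => br u (g j)) (g i) w' else 0.

End LeibnizAlgebra.

(* All families below are 0-based: e t i stands for e_{i+1}^t, and only the
   values with i < n t (resp. j < k t for x t j, i < p for f i and y i) are
   relevant. The word w t i expresses the non-generator e t i, k t <= i < n t. *)

Record adapted_basis (F : fieldType) (L : vectType F) (br : L -> L -> L)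
    (s p : nat) (n k k1 : 'I_s -> nat)
    (N : {vspace L}) (Nt : 'I_s -> {vspace L}) (A : {vspace L})
    (e x : 'I_s -> nat -> L) (f y : nat -> L) (w : 'I_s -> nat -> seq nat)
    : Prop := AdaptedBasis {
  adapted_basis_full :
    basis_of fullv
      (flatten [seq mkseq (e t) (n t) ++ mkseq (x t) (k t) | t <- enum 'I_s]
       ++ mkseq f p ++ mkseq y p);
  adapted_basis_Nt : forall t, basis_of (Nt t) (mkseq (e t) (n t));
  adapted_basis_A : basis_of A (mkseq f p);
  adapted_generators : forall t,
    basis_mod (Nt t) (bracketv br (Nt t) (Nt t)) (mkseq (e t) (k t));
  adapted_k1 : forall t, (k1 t <= k t)%N;
  adapted_notin_annr :
    forall t i, (i < k1 t)%N -> ~ annr br (Nt t) (e t i);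
  adapted_in_annr :
    forall t i, (k1 t <= i < k t)%N -> annr br (Nt t) (e t i);
  adapted_nongen : forall t i, (k t <= i < n t)%N ->
    e t i \in bracketv br (Nt t) (Nt t);
  adapted_words : forall t i, (k t <= i < n t)%N ->
    [/\ (2 <= size (w t i))%N, all (fun j => (j < k t)%N) (w t i)
      & e t i = iter_bracket br (e t) (w t i)];
  adapted_complement :
    let X := flatten [seq mkseq (x t) (k t) | t <- enum 'I_s] ++ mkseq y p in
    (N + <<X>>)%VS = fullv /\ (N :&: <<X>>)%VS = 0%VS
}.

Definition alpha (s : nat) (w : 'I_s -> nat -> seq nat) (t : 'I_s) (i j : nat)
  : nat := count_mem j (w t i).

Definition same_structure (s : nat) (k : 'I_s -> nat)
    (w : 'I_s -> nat -> seq nat) (t : 'I_s) (i m : nat) : bool :=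
  [forall r : 'I_(k t), alpha w t i r == alpha w t m r].

Inductive label (s : nat) : Type :=
  | LE of 'I_s & nat
  | LX of 'I_s & nat
  | LF of nat
  | LY of nat.
Arguments LF {s}.
Arguments LY {s}.

Definition label_valid (s p : nat) (n k : 'I_s -> nat) (u : label s) : bool :=
  match u with
  | LE t i => (i < n t)%N
  | LX t j => (j < k t)%N
  | LF i | LY i => (i < p)%N
  end.

Definition label_val (s : nat) (V : Type) (e x : 'I_s -> nat -> V)
    (f y : nat -> V) (u : label s) : V :=
  match u with
  | LE t i => e t i | LX t j => x t j | LF i => f i | LY i => y i
  end.

(* The product of two basis elements in R_1(b_1, .., b_p). *)
Definition R1_table (F : fieldType) (L : vectType F) (s : nat)
    (n k k1 : 'I_s -> nat) (e : 'I_s -> nat -> L) (f : nat -> L)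
    (w : 'I_s -> nat -> seq nat) (b : nat -> bool)
    (gamma beta : 'I_s -> nat -> nat -> nat -> F) (u v : label s) : L :=
  match u, v with
  | LE t i, LE t' j =>
      if t == t' then \sum_(k t <= r < n t) gamma t i j r *: e t r else 0
  | LE t i, LX t' j =>
      if t != t' then 0
      else if (i < k t)%N then (if i == j then e t i else 0)
      else (alpha w t i j)%:R *: e t i
  | LX t j, LE t' i =>
      if t != t' then 0
      else if (i < k t)%N then (if (i == j) && (i < k1 t)%N then - e t i else 0)
      else \sum_(k t <= l < n t | same_structure k w t i l)
             beta t j i l *: e t l
  | LF i, LY j => if i == j then f i else 0
  | LY j, LF i => if i == j then ((b i)%:R - 1) *: f i else 0
  | _, _ => 0
  end.

Section BracketTheory.
Variables (F : fieldType) (L : vectType F) (br : {bilinear L -> L -> L}).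
Implicit Types U V W : {vspace L}.

Lemma memv_bracketv U V :
  {in U & V, forall u v, br u v \in bracketv br U V}.
Proof.
move=> u v /coord_vbasis-> /coord_vbasis->.
rewrite linear_sumlz; apply: memv_suml => i _.
rewrite linear_sumr; apply: memv_suml => j _.
rewrite linearZl_LR linearZr_LR !memvZ // memv_span //.
by apply/allpairsP; exists ((vbasis U)`_i, (vbasis V)`_j); rewrite !memt_nth.
Qed.

Lemma bracketvP U V W :
  reflect {in U & V, forall u v, br u v \in W} (bracketv br U V <= W)%VS.
Proof.
apply: (iffP idP) => [sUVW u v Uu Vv | sUVW].
  by rewrite (subvP sUVW) ?memv_bracketv.
apply/span_subvP=> _ /allpairsP[[u v] /= [Uu Vv ->]].
by rewrite sUVW ?vbasis_mem.
Qed.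

End BracketTheory.

(* Main.v *)
From HB Require Import structures.
Require Import Defs.
From mathcomp Require Import all_boot all_order all_algebra.

Set Implicit Arguments.
Unset Strict Implicit.
Unset Printing Implicit Defensive.

Import GRing.Theory Num.Theory.
Local Open Scope ring_scope.

(** The theorem holds because a complement of the nilradical N of the largest possible
    dimension, dim (N / N^2), acts on N as a maximal torus, and the weights of this torus
    determine everything.

    The torus. In characteristic zero the derived algebra of a solvable Leibniz algebra is
    nilpotent ([derived_nilpotent]), so it lies in N. Hence the right action of Q on N / N^2
    is commutative, and an element of Q that acts nilpotently on N / N^2 could be adjoined
    to N ([nilpotent_adjoin]), so it is zero. A commuting family of K x K matrices of
    dimension K without nilpotent elements is diagonalizable with K independent weights
    ([commuting_torus]). This lifts to L ([torus_exists]): there are generators E_i of N and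
    an abelian complement of N with basis x_j such that [E_i, x_j] is E_i if i = j, and 0
    otherwise. Every word in the E_i is a weight vector, and its weight counts its letters.
    The weights of the E_i have multiplicity one, as those of N^2 have total degree at least
    2; so an operator on N compatible with the torus is scalar on every E_i.

    The decomposition. The projections of N onto the given factors commute with the
    brackets, hence with the torus up to maps into the center ([component_defect_center]).
    So each noncentral generator lies in one of the nonabelian factors modulo the center,
    and the central ones can only account for the abelian factor, because a nonsplit
    nonabelian algebra has its center inside its square ([center_sub_sqr]). Moving every
    generator into its factor changes it by a central element, so it is an automorphism
    of N; its inverse phi carries the given decomposition to one that is stable under the
    torus ([twist_exists], [twisted_ideal]).

    The table. A basis of the square of each new factor is extracted from the words in its
    generators. Right products with the torus are then letter counts. The right Leibniz
    identity makes all left multiplications kill symmetrized brackets, which forces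
    [x_i, E_i] to be -E_i, or E_i to be annihilated by all left multiplications
    ([left_gen_dichotomy], [left_gen_annr]); in a nonabelian factor the second case is
    membership in the right annihilator of the factor ([annr_gen_center]). Left products of
    the torus with words preserve weights, so they only involve words with the same
    letters. Finally, each factor together with its part of the torus is an ideal, and its
    nilradical is the factor, since an element with a toral part multiplies some generator
    by a nonzero scalar ([factor_nilradical]). *)

(** * Brackets, lower central series and words *)

Section BracketBasics.
Variables (F : fieldType) (L : vectType F) (br : {bilinear L -> L -> L}).
Implicit Types (U V W A S : {vspace L}) (u v x y : L).

Lemma brDl x y z : br (x + y) z = br x z + br y z. Proof. exact: linearDl. Qed.
Lemma brDr x y z : br x (y + z) = br x y + br x z. Proof. exact: linearDr. Qed.
Lemma brBl x y z : br (x - y) z = br x z - br y z. Proof. exact: linearBl. Qed.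
Lemma brBr x y z : br x (y - z) = br x y - br x z. Proof. exact: linearBr. Qed.
Lemma brNl x z : br (- x) z = - br x z. Proof. exact: linearNl. Qed.
Lemma br0l z : br 0 z = 0. Proof. exact: linear0l. Qed.
Lemma br0r z : br z 0 = 0. Proof. exact: linear0r. Qed.
Lemma brZl a x z : br (a *: x) z = a *: br x z. Proof. exact: linearZl_LR. Qed.
Lemma brZr a x z : br x (a *: z) = a *: br x z. Proof. exact: linearZr_LR. Qed.
Lemma br_suml I (r : seq I) (P : pred I) (f : I -> L) z :
  br (\sum_(i <- r | P i) f i) z = \sum_(i <- r | P i) br (f i) z.
Proof. exact: linear_sumlz. Qed.
Lemma br_sumr I (r : seq I) (P : pred I) (f : I -> L) z :
  br z (\sum_(i <- r | P i) f i) = \sum_(i <- r | P i) br z (f i).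
Proof. exact: linear_sumr. Qed.

Definition rmul x : 'End(L) := linfun (applyr br x).
Definition lmul x : 'End(L) := linfun (br x).

Lemma rmulE x u : rmul x u = br u x. Proof. by rewrite lfunE. Qed.
Lemma lmulE x u : lmul x u = br x u. Proof. by rewrite lfunE. Qed.

Lemma bracketvS U U' V V' :
  (U <= U')%VS -> (V <= V')%VS -> (bracketv br U V <= bracketv br U' V')%VS.
Proof.
move=> sU sV; apply/bracketvP => u v Uu Vv.
by rewrite memv_bracketv ?(subvP sU) ?(subvP sV).
Qed.

Lemma span_lfun_sub (f : 'End(L)) (X : seq L) W :
  {in X, forall u, f u \in W} -> {in <<X>>%VS, forall u, f u \in W}.
Proof.
move=> fXW u uX; have: f u \in (f @: <<X>>)%VS by rewrite memv_img.
rewrite limg_span; apply: subvP; apply/span_subvP => _ /mapP[y yX ->].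
exact: fXW.
Qed.

Lemma bracketv_span (X Y : seq L) W :
  {in X & Y, forall u v, br u v \in W} -> (bracketv br <<X>> <<Y>> <= W)%VS.
Proof.
move=> brXY; apply/bracketvP => u v uX vY; rewrite -rmulE.
apply: span_lfun_sub uX => {u} u uX; rewrite rmulE -lmulE.
by apply: span_lfun_sub vY => {v} v vY; rewrite lmulE; apply: brXY.
Qed.

Lemma bracketv0l V : bracketv br 0 V = 0%VS.
Proof.
apply/eqP; rewrite -subv0; apply/bracketvP => u v; rewrite !memv0 => /eqP-> _.
by rewrite br0l.
Qed.

Lemma idealP A (I : {vspace L}) : ideal br A I <->
  [/\ (I <= A)%VS, {in I & A, forall u a, br u a \in I}
    & {in A & I, forall a u, br a u \in I}].
Proof. by split=> -[sIA /bracketvP h1 /bracketvP h2]. Qed.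

Lemma lower_centralS U m : (bracketv br U U <= U)%VS ->
  (lower_central br U m.+1 <= lower_central br U m)%VS.
Proof.
by move=> sU; elim: m => //= m IH; apply: bracketvS IH (subvv U).
Qed.

Lemma lower_central_leq U m m' : (bracketv br U U <= U)%VS -> (m <= m')%N ->
  (lower_central br U m' <= lower_central br U m)%VS.
Proof.
move=> sU /subnK <-; elim: (m' - m)%N => // d IH.
exact: subv_trans (lower_centralS _ sU) IH.
Qed.

Lemma lower_central_mono U V m :
  (U <= V)%VS -> (lower_central br U m <= lower_central br V m)%VS.
Proof. by move=> sUV; elim: m => //= m IH; apply: bracketvS. Qed.

Lemma nilpotent_mono U V : (U <= V)%VS -> nilpotent_alg br V -> nilpotent_alg br U.
Proof.
move=> sUV [m Vm0]; exists m; apply/eqP; rewrite -subv0 -Vm0.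
exact: lower_central_mono.
Qed.

Definition center N : {vspace L} :=
  (N :&: \bigcap_(i < \dim N) lker (rmul (vbasis N)`_i)
     :&: \bigcap_(i < \dim N) lker (lmul (vbasis N)`_i))%VS.

Lemma centerP (N : {vspace L}) z : reflect
  [/\ z \in N, {in N, forall u, br z u = 0} & {in N, forall u, br u z = 0}]
  (z \in center N).
Proof.
rewrite !memv_cap -andbA; apply: (iffP and3P) => [[zN rz lz]|[zN rz lz]].
  split=> // u /coord_vbasis ->.
    rewrite br_sumr big1 // => i _; rewrite brZr -rmulE.
    have /subv_bigcapP/(_ i isT) := rz; rewrite -memvE memv_ker => /eqP ->.
    by rewrite scaler0.
  rewrite br_suml big1 // => i _; rewrite brZl -lmulE.
  have /subv_bigcapP/(_ i isT) := lz; rewrite -memvE memv_ker => /eqP ->.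
  by rewrite scaler0.
have bN (i : 'I_(\dim N)) : (vbasis N)`_i \in N.
  by rewrite vbasis_mem // mem_nth // size_tuple.
split=> //; apply/subv_bigcapP => i _.
  by rewrite -memvE memv_ker rmulE rz.
by rewrite -memvE memv_ker lmulE lz.
Qed.

End BracketBasics.

Section Leibniz.
Variables (F : fieldType) (L : vectType F) (br : {bilinear L -> L -> L}).
Hypothesis hleib : right_leibniz br.
Implicit Types (U V W S N : {vspace L}) (u v x y : L).

Lemma leibnizr x y z : br x (br y z) = br (br x y) z - br (br x z) y.
Proof. by rewrite hleib addrAC subrr add0r. Qed.

(** By the Leibniz identity, [x, [y, z]] is the commutator of the right
    multiplications by y and z applied to x, hence antisymmetric in y and z. *)
Lemma br_sym0 x y z : br x (br y z + br z y) = 0.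
Proof. by rewrite brDr !leibnizr addrC addrA subrK subrr. Qed.

(** Right multiplication by a commutator is a commutator of right
    multiplications, so it moves two steps down the lower central series. *)
Lemma br_lower_central_sqr U m u v : (bracketv br U U <= U)%VS ->
  u \in lower_central br U m -> v \in bracketv br U U ->
  br u v \in lower_central br U m.+2.
Proof.
move=> sU uU vU; rewrite -lmulE; apply: span_lfun_sub vU => y.
case/allpairsP=> -[a b] /= [/vbasis_mem aU /vbasis_mem bU ->].
rewrite lmulE leibnizr.
by rewrite memvB // !memv_bracketv.
Qed.

Fixpoint wordsn (k m : nat) : seq (seq nat) :=
  if m is m'.+1 then [seq rcons w j | w <- wordsn k m', j <- iota 0 k]
  else [:: [::]].

Lemma mem_wordsn k m w :
  (w \in wordsn k m) = (size w == m) && all (fun j => (j < k)%N) w.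
Proof.
elim: m w => [|m IH] w /=; first by rewrite inE; case: w.
apply/allpairsP/idP => [[[w' j] /= [w'k jk ->]]|].
  move: w'k; rewrite IH size_rcons all_rcons eqSS => /andP[-> ->].
  by move: jk; rewrite mem_iota /= => ->.
case/lastP: w => // w j; rewrite size_rcons all_rcons eqSS => /and3P[wm jk wk].
by exists (w, j) => /=; rewrite IH wm wk mem_iota jk.
Qed.

Lemma iter_bracket_rcons (g : nat -> L) w j : w != [::] ->
  iter_bracket br g (rcons w j) = br (iter_bracket br g w) (g j).
Proof. by case: w => //= i w _; rewrite foldl_rcons. Qed.

Lemma lower_central_words U (g : nat -> L) k m : (bracketv br U U <= U)%VS ->
  (U <= <<mkseq g k>> + bracketv br U U)%VS ->
  (lower_central br U m <=
     <<[seq iter_bracket br g w | w <- wordsn k m.+1]>> + lower_central br U m.+1)%VS.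
Proof.
move=> sU gU; elim: m => [|m IH].
  apply: subv_trans gU _; apply: addvS => //; apply: sub_span => _ /mapP[j jk ->].
  by apply/mapP; exists [:: j]; rewrite // mem_wordsn /= andbT;
  rewrite mem_iota in jk.
set S := (_ + _)%VS; apply/bracketvP => u v uU vU.
have sg j : (j < k)%N -> g j \in <<mkseq g k>>%VS.
  by move=> jk; apply: memv_span; apply/mapP; exists j; rewrite ?mem_iota.
have /memv_addP[u1 u1W [u2 u2W def_u]] := subvP IH _ uU.
have /memv_addP[v1 v1W [v2 v2W def_v]] := subvP gU _ vU.
have S2 : (lower_central br U m.+2 <= S)%VS by rewrite addvSr.
rewrite def_u brDl memvD //; last first.
  by apply: (subvP S2); rewrite /= memv_bracketv.
rewrite def_v brDr memvD //; last first.
  have u1U : u1 \in lower_central br U m.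
    have -> : u1 = u - u2 by rewrite def_u addrK.
    by rewrite memvB // (subvP (lower_centralS m sU)).
  by apply: (subvP S2); apply: br_lower_central_sqr.
apply: (subvP (addvSl _ _)).
apply: (subvP (bracketv_span (X := [seq iter_bracket br g w | w <- wordsn k m.+1])
  (Y := mkseq g k) _)) (memv_bracketv br u1W v1W) =>
    _ _ /mapP[w wW ->] /mapP[j jk ->].
apply: memv_span; apply/mapP; exists (rcons w j).
  by apply/allpairsP; exists (w, j).
by rewrite iter_bracket_rcons //; case: w wW => //; rewrite mem_wordsn.
Qed.

(** Descending induction from the term of the lower central series that vanishes.
    The conclusion for m = 1 says that the square of a nilpotent algebra is spanned
    by the words of length at least 2 in a set of generators. *)
Lemma lower_central_sub_words U (g : nat -> L) k m S :
  (bracketv br U U <= U)%VS -> nilpotent_alg br U ->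
  (U <= <<mkseq g k>> + bracketv br U U)%VS ->
  (forall w, (m < size w)%N -> all (fun j => (j < k)%N) w ->
     iter_bracket br g w \in S) ->
  (lower_central br U m <= S)%VS.
Proof.
move=> sU [M UM0] gU; move: (leq_addl m M); move: {2}M => d.
elim: d m => [|d IH] m leMm gS.
  rewrite addn0 in leMm.
  by apply: subv_trans (sub0v S); rewrite -UM0 lower_central_leq.
apply: subv_trans (lower_central_words m sU gU) _.
rewrite subv_add IH ?addSnnS // ?andbT => [|w /ltnW]; last exact: gS.
apply/span_subvP => _ /mapP[w wW ->]; move: wW; rewrite mem_wordsn.
by case/andP=> /eqP szw; apply: gS; rewrite szw.
Qed.

End Leibniz.

(** * Spans of sequences of vectors *)

Section VectorAux.
Variables (F : fieldType) (L : vectType F).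
Implicit Types (g : nat -> L) (c : nat -> F) (U : {vspace L}).

Lemma mkseq_mem_span g k i : (i < k)%N -> g i \in <<mkseq g k>>%VS.
Proof. by move=> ik; apply/memv_span/mapP; exists i; rewrite ?mem_iota. Qed.

Lemma span_mkseq_sub g k U :
  (forall i, (i < k)%N -> g i \in U) -> (<<mkseq g k>> <= U)%VS.
Proof.
by move=> gU; apply/span_subvP => _ /mapP[i ik ->]; apply: gU; rewrite mem_iota in ik.
Qed.

Lemma span_mkseqP g k u : reflect (exists c, u = \sum_(i < k) c i *: g i)
  (u \in <<mkseq g k>>%VS).
Proof.
apply: (iffP idP) => [|[c ->]]; last first.
  by apply: memv_suml => i _; rewrite memvZ ?mkseq_mem_span.
have szg : size (mkseq g k) == k by rewrite size_mkseq.
rewrite -[mkseq g k]/(tval (Tuple szg)) => /coord_span ->.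
pose c j := oapp (coord (Tuple szg) ^~ u) 0 (insub j).
by exists c; apply: eq_bigr => i _; rewrite /c valK /= nth_mkseq.
Qed.

Lemma free_mkseq_mod g k U :
  (forall c, \sum_(i < k) c i *: g i \in U -> forall i, (i < k)%N -> c i = 0) ->
  free (mkseq g k) /\ (<<mkseq g k>> :&: U = 0)%VS.
Proof.
move=> indep; split.
  have szg : size (mkseq g k) == k by rewrite size_mkseq.
  rewrite -[mkseq g k]/(tval (Tuple szg)); apply/freeP => c c0 i.
  have := indep (oapp c 0 \o insub) _ i (ltn_ord i); rewrite /= valK; apply.
  suff -> : \sum_(j < k) oapp c 0 (insub (val j)) *: g j = 0 by rewrite mem0v.
  by rewrite -[RHS]c0; apply: eq_bigr => j _; rewrite valK /= nth_mkseq.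
apply/eqP; rewrite -subv0; apply/subvP => u /memv_capP[/span_mkseqP[c def_u] uU].
rewrite memv0 def_u big1 // => i _; rewrite (indep c _ i) ?scale0r //.
by rewrite -def_u.
Qed.

Lemma free_mkseq_mod_eq0 g k U c : free (mkseq g k) ->
  (<<mkseq g k>> :&: U = 0)%VS -> \sum_(i < k) c i *: g i \in U ->
  forall i, (i < k)%N -> c i = 0.
Proof.
move=> freeg capg cU i ik.
have: \sum_(i < k) c i *: g i \in (<<mkseq g k>> :&: U)%VS.
  by rewrite memv_cap cU andbT; apply/span_mkseqP; exists c.
rewrite capg memv0 => /eqP c0; move: freeg.
have szg : size (mkseq g k) == k by rewrite size_mkseq.
rewrite -[mkseq g k]/(tval (Tuple szg)) => /freeP/(_ (c \o val)) /(_ _ (Ordinal ik)).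
by apply; rewrite -[RHS]c0; apply: eq_bigr => j _ /=; rewrite nth_mkseq.
Qed.

Lemma free_sub_span (A : eqType) (f : A -> L) (X : seq A) :
  exists Y : seq A, [/\ {subset Y <= X}, free (map f Y) & (<<map f Y>> =
    <<map f X>>)%VS].
Proof.
elim: X => [|v X [Y [YX freeY spanY]]]; first by exists [::]; rewrite nil_free.
have [vX|vX] := boolP (f v \in <<map f X>>%VS).
  exists Y; split=> //; first by move=> y /YX; rewrite inE orbC => ->.
  by rewrite /= span_cons spanY; apply/esym/addv_idPr; rewrite -memvE.
exists (v :: Y); split.
- by move=> y; rewrite !inE => /predU1P[->|/YX ->]; rewrite ?eqxx ?orbT.
- by rewrite /= free_cons spanY vX.
- by rewrite /= !span_cons spanY.
Qed.

End VectorAux.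

(** * Jacobson's lemma *)

Section Jacobson.
Variables (F : numFieldType) (n r : nat) (W : 'M[F]_(r, n.+1)).
Variables (X Y C : 'M[F]_n.+1).
Hypothesis defC : C = X *m Y - Y *m X.
Hypotheses (WX : stablemx W X) (WY : stablemx W Y).
Hypothesis commCY : W *m C *m Y = W *m Y *m C.
Implicit Type p : {poly F}.

Let sub_stable m (V : 'M_(m, n.+1)) A :
  stablemx W A -> (V <= W)%MS -> (V *m A <= W)%MS.
Proof. by move=> WA VW; apply: submx_trans WA; apply: submxMr. Qed.

Let WC : stablemx W C.
Proof.
rewrite defC mulmxBr !mulmxA; apply: addmx_sub; last rewrite eqmx_opp.
  exact: (sub_stable WY WX).
exact: (sub_stable WX WY).
Qed.

Let W_horner p : stablemx W (horner_mx Y p).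
Proof.
elim/poly_ind: p => [|p c IH]; first by rewrite rmorph0 mulmx0 sub0mx.
rewrite rmorphD rmorphM /= horner_mx_X horner_mx_C mulmxDr.
rewrite addmx_sub ?mul_mx_scalar ?scalemx_sub // mulmxA.
exact: sub_stable.
Qed.

Let comm_horner m (V : 'M_(m, n.+1)) p : (V <= W)%MS ->
  V *m C *m horner_mx Y p = V *m horner_mx Y p *m C.
Proof.
move=> VW; elim/poly_ind: p => [|p c IH]; first by rewrite rmorph0 !(mulmx0, mul0mx).
rewrite rmorphD rmorphM /= horner_mx_X horner_mx_C.
rewrite !mulmxDr mulmxDl.
congr (_ + _); last by rewrite !mul_mx_scalar scalemxAl.
rewrite !mulmxA IH; have /submxP[D ->] : (V *m horner_mx Y p <= W)%MS.
  exact: sub_stable (W_horner p) VW.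
by rewrite -!(mulmxA D) commCY.
Qed.

Let W_expC i : stablemx W (C ^+ i).
Proof.
elim: i => [|i IH]; first by rewrite expr0 mulmx1.
by rewrite exprSr mulmxA; apply: sub_stable.
Qed.

Let comm_exp_horner i p :
  W *m C ^+ i *m horner_mx Y p = W *m horner_mx Y p *m C ^+ i.
Proof.
elim: i => [|i IH]; first by rewrite expr0 !mulmx1.
by rewrite exprSr !mulmxA comm_horner ?W_expC // IH.
Qed.

(* Since C commutes with Y on W, X acts on polynomials in Y as the derivation
   that sends Y to C. *)
Let commutator_horner m (V : 'M_(m, n.+1)) p : (V <= W)%MS ->
  V *m X *m horner_mx Y p - V *m horner_mx Y p *m X
    = V *m horner_mx Y p^`() *m C.
Proof.
move=> VW; elim/poly_ind: p => [|p c IH].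
  by rewrite deriv0 rmorph0 !(mulmx0, mul0mx) subrr.
rewrite derivD derivM derivX derivC addr0 mulr1.
rewrite !rmorphD !rmorphM /= horner_mx_X horner_mx_C.
rewrite !mulmxDr !mulmxDl opprD addrACA !mul_mx_scalar -scalemxAl subrr addr0.
rewrite !mulmxA.
have -> : V *m horner_mx Y p^`() *m Y *m C = V *m horner_mx Y p^`() *m C *m Y.
  have /submxP[D ->] : (V *m horner_mx Y p^`() <= W)%MS.
    exact: sub_stable (W_horner _) VW.
  by rewrite -!(mulmxA D) commCY.
rewrite -IH mulmxBl defC mulmxBr !mulmxA addrA [_ - _ + _]addrAC -addrA.
by rewrite subrr addr0.
Qed.

Let deriv_step p e : W *m horner_mx Y p *m C ^+ e = 0 ->
  W *m horner_mx Y p^`() *m C ^+ (e + e.+1) = 0.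
Proof.
move=> pe0; have Wp0 : W *m C ^+ e *m horner_mx Y p = 0 by rewrite comm_exp_horner.
rewrite exprD exprS !mulmxA -comm_exp_horner.
rewrite -commutator_horner ?W_expC // Wp0 mul0mx subr0.
have /submxP[D ->] : (W *m C ^+ e *m X <= W)%MS.
  exact: sub_stable WX (W_expC e).
by rewrite -!mulmxA [W *m (_ *m _)]mulmxA pe0 mulmx0.
Qed.

(** Jacobson's lemma, relative to a stable subspace: apply the derivation that
    sends Y to C repeatedly to the characteristic polynomial of Y, until it
    becomes the constant (n + 1)!, a unit in characteristic zero. *)
Lemma jacobson_nilpotent : exists e, W *m C ^+ e = 0.
Proof.
pose p := char_poly Y.
have iter_step j : exists e, W *m horner_mx Y p^`(j) *m C ^+ e = 0.
  elim: j => [|j [e IH]].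
    by exists 0; rewrite derivn0 Cayley_Hamilton mulmx0 mul0mx.
  by exists (e + e.+1)%N; rewrite derivnS; apply: deriv_step.
have [e] := iter_step n.+1.
have -> : p^`(n.+1) = (n.+1)`!%:R%:P.
  apply/polyP => i; rewrite coef_derivn coefC.
  case: i => [|i] /=.
    have := char_poly_monic Y; rewrite monicE lead_coefE size_char_poly /=.
    by rewrite addn0 => /eqP ->; rewrite ffactnn.
  by rewrite nth_default ?mul0rn // size_char_poly addnS ltnS leq_addr.
rewrite horner_mx_C mul_mx_scalar -scalemxAl => /eqP.
rewrite scalemx_eq0 pnatr_eq0 gtn_eqF ?fact_gt0 //= => /eqP eC.
by exists e.
Qed.
End Jacobson.

(** * Representations of solvable Leibniz algebras *)

(** Commuting nilpotent operators have a common null vector: each operator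
    preserves the joint kernel of the previous ones, and is nilpotent there. *)
Lemma common_kernel (F : fieldType) (n : nat) (W : 'M[F]_n.+1)
    (As : seq 'M[F]_n.+1) : W != 0 ->
  {in As, forall A, stablemx W A} ->
  {in As &, forall A B, W *m A *m B = W *m B *m A} ->
  {in As, forall A, exists e, W *m A ^+ e = 0} ->
  exists v : 'rV_n.+1, [/\ v != 0, (v <= W)%MS & {in As, forall A, v *m A = 0}].
Proof.
move=> W0; elim: As => [|A As IH] stabW comW nilW.
  by exists (nz_row W); rewrite nz_row_eq0 nz_row_sub.
have AsA B : B \in As -> B \in A :: As by rewrite inE orbC => ->.
have [||| v [v0 vW vAs]] := IH.
- by move=> B /AsA; apply: stabW.
- by move=> B B' /AsA BA /AsA; apply: comW.
- by move=> B /AsA; apply: nilW.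
have [e We0] := nilW A (mem_head _ _).
have vAW i : (v *m A ^+ i <= W)%MS.
  elim: i => [|i IHi]; first by rewrite expr0 mulmx1.
  rewrite exprSr mulmxA; apply: submx_trans (stabW _ (mem_head _ _)).
  exact: submxMr.
have vAB i B : B \in As -> v *m A ^+ i *m B = 0.
  move=> BAs; elim: i => [|i IHi]; first by rewrite expr0 mulmx1 vAs.
  have /submxP[D defD] := vAW i.
  rewrite exprSr mulmxA defD -!mulmxA [W *m (_ *m _)]mulmxA.
  by rewrite comW ?mem_head ?AsA // !mulmxA -defD IHi mul0mx.
have exe : exists e, v *m A ^+ e == 0.
  by have /submxP[D ->] := vW; exists e; rewrite -mulmxA We0 mulmx0.
case: (ex_minnP exe) => -[|m] vm0 minm.
  by move: vm0 v0; rewrite expr0 mulmx1 => ->.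
exists (v *m A ^+ m); split=> //.
  by apply/negP => /minm; rewrite ltnn.
move=> B; rewrite inE => /predU1P[->|]; last exact: vAB.
by rewrite -mulmxA mulmxE -exprSr; apply/eqP.
Qed.

Section Representation.
Variables (F : numFieldType) (L : vectType F) (br : {bilinear L -> L -> L}).
Hypothesis hleib : right_leibniz br.
Local Notation D := (derived_series br fullv).

Lemma derived_series_right m : {in D m, forall u a, br u a \in D m}.
Proof.
elim: m => [|m IH] u uD a; first exact: memvf.
rewrite -rmulE; apply: span_lfun_sub uD => {u} u; case/allpairsP=> -[b c] /=.
case=> /vbasis_mem bD /vbasis_mem cD ->; rewrite rmulE hleib.
by rewrite memvD // memv_bracketv // IH.
Qed.

Lemma derived_series_leq m m' : (m <= m')%N -> (D m' <= D m)%VS.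
Proof.
move=> /subnK <-; elim: (m' - m)%N => // d IH; apply: subv_trans IH.
apply/bracketvP => u v uD vD; exact: derived_series_right.
Qed.

Variables (n : nat) (rho : {linear L -> 'M[F]_n.+1}).
Hypothesis rhoM : forall a b, rho (br a b) = rho a *m rho b - rho b *m rho a.

Let stable (W : 'M_n.+1) := forall a, stablemx W (rho a).
Let killed (W : 'M_n.+1) (S : {vspace L}) := {in S, forall c, W *m rho c = 0}.

(* The joint kernel of an ideal S is stable under L, so it can replace W. *)
Let killed_step W (S : {vspace L}) (cs : seq L) : W != 0 -> stable W ->
  <<cs>>%VS = S -> {in S, forall c a, br c a \in S} ->
  {in S &, forall c d, W *m rho c *m rho d = W *m rho d *m rho c} ->
  {in cs, forall c, exists e, W *m rho c ^+ e = 0} ->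
  exists W', [/\ W' != 0, stable W', (W' <= W)%MS & killed W' S].
Proof.
move=> W0 stW defS idS comS nilS.
have csS c : c \in cs -> c \in S by rewrite -defS; apply: memv_span.
have [||| v [v0 vW vcs]] := @common_kernel _ _ W (map rho cs) W0.
- by move=> _ /mapP[c _ ->]; apply: stW.
- by move=> _ _ /mapP[c /csS cS ->] /mapP[d /csS dS ->]; apply: comS.
- by move=> _ /mapP[c ccs ->]; apply: nilS.
pose W' := (W :&: \bigcap_(c <- cs) kermx (rho c))%MS.
have spanS m (u : 'M_(m, n.+1)) :
    {in cs, forall c, u *m rho c = 0} -> {in S, forall c, u *m rho c = 0}.
  move=> ucs c; rewrite -defS => ccs.
  pose g := linfun (mulmx u \o rho) : 'Hom(L, 'M_(m, n.+1)).
  have -> : u *m rho c = g c by rewrite lfunE.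
  apply/eqP; rewrite -memv_ker; apply: subvP ccs; apply/span_subvP => d dcs.
  by rewrite memv_ker lfunE /= ucs.
have inW' m (u : 'M_(m, n.+1)) :
    (u <= W')%MS <-> (u <= W)%MS /\ {in S, forall c, u *m rho c = 0}.
  rewrite sub_capmx; split=> [/andP[uW uK]|[uW uS]]; last first.
    rewrite uW /= big_tnth; apply/sub_bigcapmxP => i _; apply/sub_kermxP/uS/csS.
    exact: mem_tnth.
  split=> //; apply: spanS => c /seq_tnthP[i ->]; apply/sub_kermxP.
  by move: uK; rewrite big_tnth => /sub_bigcapmxP; apply.
exists W'; split.
- apply: contraNneq v0 => W'0; rewrite -submx0 -W'0; apply/inW'; split=> //.
  by apply: spanS => c ccs; rewrite vcs ?map_f.
- move=> a; apply/inW'; have [W'W W'S] := (inW' _ W').1 (submx_refl _).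
  split; first by apply: submx_trans (stW a); apply: submxMr.
  move=> c cS; have := W'S _ (idS c cS a); rewrite rhoM mulmxBr !mulmxA W'S //.
  by rewrite mul0mx sub0r => /eqP; rewrite oppr_eq0 => /eqP.
- exact: capmxSl.
- by have [_] := (inW' _ W').1 (submx_refl _).
Qed.

Hypothesis hsolv : solvable_alg br fullv.

(* First [D m.+1, L] is made to act by zero: by Jacobson's lemma it is spanned by
   elements acting nilpotently. Then D m.+1 is central in the image of L, and
   Jacobson's lemma applies to the commutators that span it. *)
Let killed_descent m W : W != 0 -> stable W -> killed W (D m.+2) ->
  exists W', [/\ W' != 0, stable W' & killed W' (D m.+1)].
Proof.
move=> W0 stW kW.
have comD V : (V <= W)%MS ->
    {in D m.+1 &, forall c d, V *m rho c *m rho d = V *m rho d *m rho c}.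
  move=> /submxP[E ->] c d cD dD; rewrite -!mulmxA; congr (E *m _).
  apply/eqP; rewrite -subr_eq0 -mulmxBr -rhoM kW //; exact: memv_bracketv.
pose cs1 := [seq br d a | d <- vbasis (D m.+1), a <- vbasis fullv].
have cs1D : {in cs1, forall c, c \in D m.+1}.
  move=> _ /allpairsP[[d a] [/vbasis_mem dD _ ->]]; exact: derived_series_right.
have S1D : (bracketv br (D m.+1) fullv <= D m.+1)%VS.
  by apply/bracketvP => u a uD _; apply: derived_series_right.
have [|||W1 [W10 stW1 W1W kW1]] := @killed_step W _ cs1 W0 stW erefl.
- move=> c cS a; apply: memv_bracketv; last exact: memvf.
  exact: subvP S1D _ cS.
- by move=> c d /(subvP S1D) cD /(subvP S1D); apply: comD.
- move=> _ /allpairsP[[d a] [/vbasis_mem dD _ ->]] /=.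
  have [||||e We] := @jacobson_nilpotent _ _ _ W (rho a) (rho d) (- rho (br d a)).
  + by rewrite rhoM opprB.
  + exact: stW.
  + exact: stW.
  + rewrite !mulmxN !mulNmx; congr (- _).
    by apply: comD => //; apply: derived_series_right.
  exists e; apply/eqP; move: We; rewrite exprNn -signr_odd.
  by case: odd; rewrite ?expr1 ?expr0 ?mulN1r ?mul1r ?mulmxN => /eqP;
    rewrite ?oppr_eq0.
have [|||W2 [W20 stW2 _ kW2]] := @killed_step W1 (D m.+1)
    [seq br u v | u <- vbasis (D m), v <- vbasis (D m)] W10 stW1 erefl.
- by move=> c cD a; apply: derived_series_right.
- exact: comD.
- move=> _ /allpairsP[[b d] /= [/vbasis_mem bD /vbasis_mem dD ->]].
  apply: (@jacobson_nilpotent _ _ _ W1 (rho b) (rho d)) => //.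
  apply/eqP; rewrite -subr_eq0 -!mulmxA -mulmxBr -rhoM.
  by rewrite kW1 // memv_bracketv ?memvf // memv_bracketv.
by exists W2.
Qed.

(** The substitute for Lie's theorem: going up the derived series from its
    vanishing term, a stable subspace killed by one term contains a stable subspace
    killed by the previous one, down to the derived algebra itself. *)
Lemma derived_common_kernel :
  exists2 v : 'rV_n.+1, v != 0 & {in bracketv br fullv fullv, forall c,
    v *m rho c = 0}.
Proof.
have [M DM0] := hsolv.
have: exists W, [/\ W != 0, stable W & killed W (D M.+1)].
  exists 1%:M; split=> [|a|c].
  - exact: oner_neq0.
  - exact: submx1.
  - move/(subvP (derived_series_leq (leqnSn M))); rewrite DM0 memv0 => /eqP->.
    by rewrite linear0 mulmx0.
elim: M {DM0} => [|M IH] [W [W0 stW kW]]; last first.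
  by apply: IH; apply: killed_descent kW.
exists (nz_row W); rewrite ?nz_row_eq0 // => c cD.
by have /submxP[E ->] := nz_row_sub W; rewrite -mulmxA kW ?mulmx0.
Qed.
End Representation.

(** The dual representation turns a common null vector into a common null linear
    form. *)
Lemma derived_common_cokernel (F : numFieldType) (L : vectType F)
    (br : {bilinear L -> L -> L}) (n : nat) (rho : {linear L -> 'M[F]_n.+1}) :
  right_leibniz br -> solvable_alg br fullv ->
  (forall a b, rho (br a b) = rho a *m rho b - rho b *m rho a) ->
  exists2 u : 'cV_n.+1, u != 0 &
    {in bracketv br fullv fullv, forall c, rho c *m u = 0}.
Proof.
move=> hleib hsolv rhoM.
have [|v v0 vK] := @derived_common_kernel _ _ _ hleib n (-%R \o (trmx \o rho)) _
  hsolv.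
  move=> a b /=; rewrite rhoM linearB /= !trmx_mul !(mulmxN, mulNmx) !opprK.
  by rewrite opprB.
exists v^T => [|c cD]; first by rewrite -trmx0 (inj_eq trmx_inj).
apply: trmx_inj; rewrite trmx_mul trmxK trmx0.
by apply/eqP; rewrite -oppr_eq0 -mulmxN; apply/eqP/vK.
Qed.

(** * Subquotient representations and nilpotency of the derived algebra *)

Section Coordinates.
Variables (F : fieldType) (L : vectType F) (U : {vspace L}).
Variables (K : nat) (X : K.-tuple L).
Local Notation W := (<<X>> + U)%VS.

Definition coord_mod (w : L) : 'rV[F]_K :=
  \row_i coord X i (daddv_pi <<X>> U w).

Fact coord_mod_linear : linear coord_mod.
Proof. by move=> a u v; apply/rowP => i; rewrite !mxE !linearP. Qed.
HB.instance Definition _ :=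
  GRing.isLinear.Build F L 'rV[F]_K _ coord_mod coord_mod_linear.

Hypotheses (freeX : free X) (capX : (<<X>> :&: U = 0)%VS).

Lemma coord_modX (i : 'I_K) : coord_mod X`_i = delta_mx 0 i.
Proof.
apply/rowP => j; rewrite !mxE eqxx /= daddv_pi_id // ?coord_free // 1?eq_sym //.
by rewrite memv_span // mem_nth // size_tuple.
Qed.

Lemma coord_mod_sum w : w \in W -> w - \sum_i coord_mod w 0 i *: X`_i \in U.
Proof.
move=> wW; have := daddv_pi_add capX wW; set a := daddv_pi _ _ w => def_w.
rewrite -{1}def_w [X in _ - X](_ : _ = a);
first by rewrite addrAC subrr add0r memv_pi.
rewrite [RHS](coord_span (memv_pi _ _ w)).
by apply: eq_bigr => i _; rewrite mxE.
Qed.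

Lemma coord_mod_eq0 w : w \in W -> (coord_mod w == 0) = (w \in U).
Proof.
move=> wW; apply/eqP/idP => [w0|wU].
  have := coord_mod_sum wW; rewrite w0 big1 ?subr0 // => i _.
  by rewrite mxE scale0r.
apply/rowP => i; rewrite !mxE.
suff -> : daddv_pi <<X>> U w = 0 by rewrite linear0.
have := daddv_pi_add capX wW; rewrite (daddv_pi_id (V := <<X>>%VS) _ wU).
  by move/eqP; rewrite -subr_eq0 addrK => /eqP.
by rewrite capvC.
Qed.

Variable br : {bilinear L -> L -> L}.

(** The matrix of the right action of a on the subquotient with basis X. *)
Definition rep_mod (a : L) : 'M[F]_K := \matrix_(i, j) coord_mod (br X`_i a) 0 j.

Fact rep_mod_linear : linear rep_mod.
Proof.
move=> c a b; apply/matrixP => i j.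
by rewrite mxE brDr brZr linearP !mxE.
Qed.
HB.instance Definition _ :=
  GRing.isLinear.Build F L 'M[F]_K _ rep_mod rep_mod_linear.

Lemma row_rep_mod i a : row i (rep_mod a) = coord_mod (br X`_i a).
Proof. by apply/rowP => j; rewrite mxE mxE. Qed.

Hypothesis hleib : right_leibniz br.
Hypotheses (W_right : {in W, forall w a, br w a \in W})
           (U_right : {in U, forall u a, br u a \in U}).

Lemma coord_mod_br w a : w \in W -> coord_mod (br w a) = coord_mod w *m rep_mod a.
Proof.
move=> wW; have wU := coord_mod_sum wW.
have -> : br w a = br (w - \sum_i coord_mod w 0 i *: X`_i) a
    + \sum_i coord_mod w 0 i *: br X`_i a.
  rewrite brBl br_suml -[LHS](subrK (br (\sum_i coord_mod w 0 i *: X`_i) a)).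
  by rewrite br_suml; congr (_ + _); apply: eq_bigr => i _; rewrite brZl.
rewrite linearD /= (eqP (_ : coord_mod (br _ a) == 0)); last first.
  by rewrite coord_mod_eq0 ?U_right // (subvP (addvSr _ _)) ?U_right.
rewrite add0r linear_sum mulmx_sum_row /=; apply: eq_bigr => i _.
by rewrite linearZ row_rep_mod.
Qed.

Lemma rep_modM a b :
  rep_mod (br a b) = rep_mod a *m rep_mod b - rep_mod b *m rep_mod a.
Proof.
have XW i : X`_i \in W.
  have [iK|Ki] := ltnP i K; last by rewrite nth_default ?size_tuple ?mem0v.
  by rewrite (subvP (addvSl _ _)) // memv_span // mem_nth ?size_tuple.
apply/row_matrixP => i; rewrite linearB /= !row_mul !row_rep_mod.
by rewrite leibnizr // linearB /= !coord_mod_br ?W_right.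
Qed.

End Coordinates.

Section Solvable.
Variables (F : numFieldType) (L : vectType F) (br : {bilinear L -> L -> L}).
Hypotheses (hleib : right_leibniz br) (hsolv : solvable_alg br fullv).
Local Notation L2 := (bracketv br fullv fullv).

(** The derived algebra kills a nonzero linear form on W. *)
Lemma solvable_not_perfect (W : {vspace L}) : {in W, forall w a, br w a \in W} ->
  W != 0%VS -> ~~ (W <= bracketv br W L2)%VS.
Proof.
move=> W_right W0; apply/negP => Wperf.
move: (vbasisP W) (W0); rewrite -dimv_eq0; move: (vbasis W).
case def_d: (\dim W) => [//|d] X /andP[/eqP spanX freeX] _.
have capX : (<<X>> :&: 0 = 0)%VS by rewrite capv0.
have defW : (<<X>> + 0)%VS = W by rewrite addv0.
have Wr : {in (<<X>> + 0)%VS, forall w a, br w a \in (<<X>> + 0)%VS} by rewrite defW.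
have Ur : {in 0%VS, forall u a, br u a \in 0%VS}.
  by move=> u; rewrite memv0 => /eqP-> a; rewrite br0l mem0v.
have rhoM := rep_modM capX hleib Wr Ur.
have [u u0 uK] := derived_common_cokernel hleib hsolv rhoM.
pose phi := linfun (mulmxr u \o coord_mod 0 X) : 'Hom(L, 'M[F]_1).
have phiW : (W <= lker phi)%VS.
  apply: subv_trans Wperf _; apply/bracketvP => w c wW cD.
  rewrite memv_ker lfunE /= (coord_mod_br capX Ur) ?defW //.
  by rewrite -mulmxA uK // mulmx0.
case/eqP: u0; apply/colP => i; rewrite [RHS]mxE.
have /(subvP phiW) : X`_i \in W by rewrite -spanX memv_span // mem_nth ?size_tuple.
rewrite memv_ker lfunE /= coord_modX // -rowE => /eqP/matrixP/(_ 0 0).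
by rewrite !mxE.
Qed.

(** The iterated right action of the derived algebra on L yields right ideals that
    shrink strictly until they vanish. *)
Lemma derived_nilpotent : nilpotent_alg br L2.
Proof.
pose V m := iter m (fun U => bracketv br U L2) fullv.
have V_right m : {in V m, forall v a, br v a \in V m}.
  elim: m => [|m IH] v vV a; first exact: memvf.
  rewrite -rmulE; apply: span_lfun_sub vV => {v} v; case/allpairsP=> -[u c] /=.
  case=> /vbasis_mem uV /vbasis_mem cL ->; rewrite rmulE hleib.
  by rewrite memvD // memv_bracketv ?IH // memv_bracketv ?memvf.
have dimV m : (\dim (V m) <= \dim {:L} - m)%N.
  elim: m => [|m IH]; first by rewrite subn0.
  have [V0|V0] := eqVneq (V m) 0%VS.
    by rewrite [V _]/= V0 bracketv0l dimv0.
  have ltV : (\dim (V m.+1) < \dim (V m))%N.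
    rewrite ltn_neqAle dimvS ?andbT; last first.
      by apply/bracketvP => v c vV _; apply: V_right.
    apply: contraNneq (solvable_not_perfect (V_right m) V0) => dimE.
    rewrite -[(_ <= _)%VS]/(V m <= V m.+1)%VS -(eqP (_ : V m.+1 == V m)) ?subvv //.
    rewrite eqEdim dimE leqnn andbT.
    by apply/bracketvP => v c vV _; apply: V_right.
  by rewrite subnS -ltnS prednK ?(leq_trans ltV) // (leq_ltn_trans _ (leq_trans ltV
    IH)).
exists (\dim {:L}); apply/eqP; rewrite -dimv_eq0 -leqn0 -(subnn (\dim {:L})).
apply: leq_trans (dimV _); apply: dimvS; elim: (\dim {:L}) => [|m IH].
  exact: subvf.
exact: bracketvS.
Qed.

Variable N : {vspace L}.
Hypothesis hN : nilradical br fullv N.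

Lemma ideal_derived_sub J : (L2 <= J)%VS -> ideal br fullv J.
Proof.
by move=> sJ; apply/idealP; split=> [|u a _ _|a u _ _]; rewrite ?subvf //;
  apply: (subvP sJ); rewrite memv_bracketv ?memvf.
Qed.

Lemma derived_sub_nilradical : (L2 <= N)%VS.
Proof.
by case: hN => _ _; apply; [apply: ideal_derived_sub | apply: derived_nilpotent].
Qed.

End Solvable.

(** * Commuting families of matrices of maximal dimension *)

Lemma simmx_pow (F : fieldType) n (P A T : 'M[F]_n.+1) r :
  P *m A = T *m P -> P *m A ^+ r = T ^+ r *m P.
Proof.
move=> PA; elim: r => [|r IH]; first by rewrite !expr0 mulmx1 mul1mx.
by rewrite exprSr [in RHS]exprSr mulmxA IH -!mulmxA PA.
Qed.

(** After simultaneous triangularization, the diagonal entries are linear forms on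
    Q that vanish jointly only at nilpotent elements, so they are coordinates on Q.
    Hence Q contains an element with diagonal entries 1, .., n + 1; whatever commutes
    with it is diagonal in its eigenbasis, and the eigenvalues are coordinates on Q
    again. *)
Lemma commuting_torus_succ (C : numClosedFieldType) (L : vectType C)
    (Q : {vspace L}) n (rho : {linear L -> 'M[C]_n.+1}) :
  {in Q &, forall a b, rho a *m rho b = rho b *m rho a} -> \dim Q = n.+1 ->
  {in Q, forall a, forall r, rho a ^+ r = 0 -> a = 0} ->
  exists V : 'M[C]_n.+1, V \in unitmx /\
  exists q : 'I_n.+1 -> L, (forall j, q j \in Q) /\
    forall i j, row i V *m rho (q j) = (i == j)%:R *: row i V.
Proof.
move=> comQ dimQ nilQ.
have [|P /unitarymx_unit Pu /allP trigP] :=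
    @cotrigonalization C n.+1 [seq rho a | a <- vbasis Q].
  by move=> _ _ /mapP[a /vbasis_mem aQ ->] /mapP[b /vbasis_mem bQ ->]; apply: comQ.
pose T a := P *m rho a *m invmx P.
have Tlin : linear T.
  by move=> c a b; rewrite /T linearP mulmxDr mulmxDl -scalemxAr -scalemxAl.
have PT a : P *m rho a = T a *m P by rewrite /T mulmxKV.
have TE a : T a = P *m rho a *m invmx P by [].
clearbody T.
have trigT : {in Q, forall a, is_trig_mx (T a)}.
  move=> a aQ; apply/is_trig_mxP => i j ij.
  pose TL := GRing.isLinear.Build _ _ _ _ T Tlin.
  pose TLn : {linear _ -> _} := HB.pack T TL.
  rewrite (coord_vbasis aQ) -[T _]/(TLn _) linear_sum summxE big1 // => k _.
  rewrite linearZ mxE /= TE -conjumx //.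
  suff /is_trig_mxP/(_ _ _ ij) -> : is_trig_mx (conjmx P (rho (vbasis Q)`_k)).
    by rewrite mulr0.
  by apply: (trigP (rho _)); rewrite map_f // mem_nth // size_tuple.
pose dg a := \row_i T a i i.
have dglin : linear dg by move=> c a b; apply/rowP => i; rewrite !mxE Tlin !mxE.
pose dL := GRing.isLinear.Build _ _ _ _ dg dglin.
pose dLn : {linear _ -> _} := HB.pack dg dL.
pose d : 'Hom(L, 'rV_n.+1) := linfun dLn.
have dE a : d a = dg a by rewrite lfunE.
have d0 : (Q :&: lker d = 0)%VS.
  apply/eqP; rewrite -subv0; apply/subvP => a; rewrite memv_cap => /andP[aQ].
  rewrite memv_ker dE memv0 => /eqP da0; apply/eqP/(nilQ a aQ n.+1).
  have: T a ^+ n.+1 = 0.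
    have := Cayley_Hamilton (T a); rewrite char_poly_trig ?trigT //.
    rewrite (eq_bigr (fun=> 'X)) => [|i _].
      by rewrite prodr_const card_ord rmorphXn /= horner_mx_X.
    by have /rowP/(_ i) := da0; rewrite !mxE => ->; rewrite subr0.
  move=> Tn0; apply: (can_inj (mulKmx Pu)).
  by rewrite (simmx_pow _ (PT a)) Tn0 mul0mx mulmx0.
have surj (N : {vspace L}) (f : 'Hom(L, 'rV[C]_n.+1)) u : (N :&: lker f = 0)%VS ->
    \dim N = n.+1 -> exists2 a, a \in N & f a = u.
  move=> f0 dimN; have : u \in (f @: N)%VS.
    suff -> : (f @: N = fullv)%VS by rewrite memvf.
    apply/eqP; rewrite eqEdim subvf limg_dim_eq // dimN dimvf /dim /= mul1n.
    by rewrite leqnn.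
  by case/memv_imgP => a aN ->; exists a.
have [h hQ dh] := surj Q d (\row_i i.+1%:R) d0 dimQ.
pose ev (i : 'I_n.+1) : C := i.+1%:R.
have ev_inj : injective ev.
  by move=> i j /eqP; rewrite eqr_nat eqSS => /eqP/val_inj.
have eigh i : exists v : 'rV_n.+1, v *m rho h == ev i *: v /\ v != 0.
  have: eigenvalue (T h) (ev i).
    rewrite eigenvalue_root_char char_poly_trig ?trigT // /root horner_prod.
    rewrite (bigD1 i) //= hornerXsubC; have := dE h; rewrite dh => /rowP/(_ i).
    by rewrite !mxE => <-; rewrite subrr mul0r.
  case/eigenvalueP => v vT v0; exists (v *m P); split.
    by rewrite -mulmxA PT mulmxA vT scalemxAl.
  by apply: contraNneq v0 => /(canRL (mulmxK Pu)) ->; rewrite mul0mx.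
have [v vh] := fin_all_exists eigh.
pose V := \matrix_i v i.
have Vu : V \in unitmx.
  rewrite -row_free_unit -kermx_eq0; apply/rowV0P => u /sub_kermxP uV.
  have dxE : mxdirect (\sum_i eigenspace (rho h) (ev i))%MS.
    by apply: mxdirect_sum_eigenspace => i j _ _; apply: ev_inj.
  have uvE i : (u 0 i *: v i <= eigenspace (rho h) (ev i))%MS.
    by apply/scalemx_sub/eigenspaceP/eqP; case: (vh i).
  apply/rowP => i; rewrite [RHS]mxE; apply/eqP.
  have: u 0 i *: v i == 0.
    rewrite -submx0 -(mxdirect_sumsP dxE i isT) sub_capmx uvE /=.
    have := uV; rewrite mulmx_sum_row (bigD1 i) //= rowK => /eqP.
    rewrite addr_eq0 => /eqP ->; rewrite eqmx_opp summx_sub // => j ji.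
    by rewrite rowK (sumsmx_sup j) // uvE.
  by rewrite scaler_eq0; case: (vh i) => _ /negPf ->; rewrite orbF.
pose B a := V *m rho a *m invmx V.
have VB a : V *m rho a = B a *m V by rewrite /B mulmxKV.
have Blin : linear B.
  by move=> c a b; rewrite /B linearP mulmxDr mulmxDl -scalemxAr -scalemxAl.
clearbody B.
(* B a commutes with a diagonal matrix with distinct entries. *)
have diagB : {in Q, forall a i j, i != j -> B a i j = 0}.
  move=> a aQ i j ij; pose Dh := diag_mx (\row_k ev k).
  have VD : V *m rho h = Dh *m V.
    rewrite mul_diag_mx; apply/row_matrixP => k; rewrite row_mul rowK.
    by case: (vh k) => /eqP -> _; apply/rowP => l; rewrite !mxE.
  have BD : B a *m Dh = Dh *m B a.
    apply: (can_inj (mulmxK Vu)); rewrite -!mulmxA -VD -VB !mulmxA -VB -VD -!mulmxA.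
    by rewrite comQ.
  have /matrixP/(_ i j) := BD; rewrite mul_mx_diag mul_diag_mx !mxE => /eqP.
  rewrite mulrC -subr_eq0 -mulrBl mulf_eq0 subr_eq0 (inj_eq ev_inj) eq_sym.
  by rewrite (negPf ij) => /eqP.
pose mu a := \row_i B a i i.
have mulin : linear mu.
  by move=> c a b; apply/rowP => i; rewrite !mxE Blin !mxE.
pose mL := GRing.isLinear.Build _ _ _ _ mu mulin.
pose mLn : {linear _ -> _} := HB.pack mu mL.
pose m : 'Hom(L, 'rV_n.+1) := linfun mLn.
have mE a i : m a 0 i = B a i i by rewrite lfunE mxE.
have rowB a i : a \in Q -> row i V *m rho a = m a 0 i *: row i V.
  move=> aQ; rewrite -row_mul VB row_mul mulmx_sum_row (bigD1 i) //= big1 => [|j ji].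
    by rewrite addr0 mE mxE.
  by rewrite mxE diagB ?scale0r // eq_sym.
have m0 : (Q :&: lker m = 0)%VS.
  apply/eqP; rewrite -subv0; apply/subvP => a; rewrite memv_cap => /andP[aQ].
  rewrite memv_ker memv0 => /eqP ma0; apply/eqP/(nilQ a aQ 1).
  rewrite expr1; apply: (can_inj (mulKmx Vu)); rewrite mulmx0.
  by apply/row_matrixP => i; rewrite row_mul rowB // ma0 mxE scale0r row0.
have exq j : exists q, q \in Q /\ m q = delta_mx 0 j.
  by have [q qQ mq] := surj Q m (delta_mx 0 j) m0 dimQ; exists q.
have [q qP] := fin_all_exists exq.
exists V; split=> //; exists q; split=> [j|i j]; first by case: (qP j).
by case: (qP j) => qQ mq; rewrite rowB // mq mxE eqxx.
Qed.

(** * Derivations acting on the lower central series *)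

Lemma commuting_torus (C : numClosedFieldType) (L : vectType C)
    (Q : {vspace L}) n (rho : {linear L -> 'M[C]_n}) :
  {in Q &, forall a b, rho a *m rho b = rho b *m rho a} -> \dim Q = n ->
  {in Q, forall a, forall r, rho a ^+ r = 0 -> a = 0} ->
  exists V : 'M[C]_n, V \in unitmx /\
  exists q : 'I_n -> L, (forall j, q j \in Q) /\
    forall i j, row i V *m rho (q j) = (i == j)%:R *: row i V.
Proof.
case: n rho => [|n] rho comQ dimQ nilQ; last exact: commuting_torus_succ.
by exists 1%:M; rewrite unitmx1; split=> //; exists (fun=> 0); split=> -[].
Qed.

Section Derivation.
Variables (F : fieldType) (L : vectType F) (br : {bilinear L -> L -> L}).
Hypothesis hleib : right_leibniz br.
Variable N : {vspace L}.
Hypothesis idN : ideal br fullv N.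
Local Notation lcN := (lower_central br N).

Lemma ideal_right : {in N, forall u a, br u a \in N}.
Proof. by have /idealP[_ h _] := idN => u uN a; apply: h; rewrite ?memvf. Qed.

Lemma ideal_subalgebra : (bracketv br N N <= N)%VS.
Proof. by apply/bracketvP => u v uN _; apply: ideal_right. Qed.

Lemma lower_central_right m : {in lcN m, forall u a, br u a \in lcN m}.
Proof.
elim: m => [|m IH]; first exact: ideal_right.
move=> u uN a; rewrite -rmulE; apply: span_lfun_sub uN => {u} u.
case/allpairsP=> -[v w] /= [/vbasis_mem vN /vbasis_mem wN ->]; rewrite rmulE hleib.
by rewrite memvD // memv_bracketv ?IH // ideal_right.
Qed.

Definition rpow a r : 'End(L) := iter r (comp_lfun (rmul br a)) \1%VF.

Lemma rpowS a r u : rpow a r.+1 u = br (rpow a r u) a.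
Proof. by rewrite comp_lfunE rmulE. Qed.
Lemma rpow0 a u : rpow a 0 u = u. Proof. exact: id_lfunE. Qed.
Lemma rpowSr a r u : rpow a r.+1 u = rpow a r (br u a).
Proof. by elim: r => [|r IH]; rewrite ?rpowS ?rpow0 // -IH rpowS. Qed.

Lemma rpow_lower_central m a r : {in lcN m, forall u, rpow a r u \in lcN m}.
Proof.
by move=> u uN; elim: r => [|r IH]; rewrite ?rpow0 // rpowS lower_central_right.
Qed.

(** Induction on p + q: the derivation is applied to one factor or to the other,
    and the bracket sinks as soon as one of the two has sunk. *)
Lemma rpow_bracket m a p q u v : u \in lcN m -> v \in N ->
  rpow a p u \in lcN m.+1 -> rpow a q v \in lcN 1 ->
  rpow a (p + q) (br u v) \in lcN m.+2.
Proof.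
have [d] := ubnP (p + q); elim: d p q u v => // d IH p q u v lt uN vN up vq.
case: p => [|p] in lt up *.
  rewrite rpow_lower_central // memv_bracketv //; by rewrite rpow0 in up.
case: q => [|q] in lt vq *.
  rewrite rpow_lower_central // br_lower_central_sqr ?ideal_subalgebra //.
  by rewrite rpow0 in vq.
rewrite addSn rpowSr hleib [X in X \in _]linearD memvD //.
  by apply: IH; rewrite ?lower_central_right // -rpowSr.
rewrite addnS -addSn; apply: IH; rewrite ?ideal_right // -?rpowSr //.
by move: lt; rewrite addnS ltnS.
Qed.

(** The quotients of the lower central series are spanned by brackets, so a
    derivation that is nilpotent on N / N^2 is nilpotent on all of them. *)
Lemma rpow_nilpotent_mod a r : {in N, forall u, rpow a r u \in lcN 1} ->
  forall m, {in lcN m, forall u, rpow a (r * m.+1) u \in lcN m.+1}.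
Proof.
move=> rN; elim=> [|m IH] u uN; first by rewrite muln1 rN.
apply: span_lfun_sub uN => {u} u.
case/allpairsP=> -[v w] /= [/vbasis_mem vN /vbasis_mem wN ->].
by rewrite mulnS addnC rpow_bracket ?IH ?rN.
Qed.

(** The lower central series of N is refined by the images of the powers of the
    right multiplication by a; every bracket with N + <a> goes down one step of the
    refined series. *)
Lemma nilpotent_adjoin a r : nilpotent_alg br N ->
  (bracketv br fullv fullv <= N)%VS ->
  {in N, forall u, rpow a r u \in lcN 1} -> nilpotent_alg br (N + <[a]>)%VS.
Proof.
move=> [M NM0] L2N rN; set J := (_ + _)%VS.
suff [m Jm] : exists m, (lower_central br J m <= lcN M)%VS.
  by exists m; apply/eqP; rewrite -subv0 -NM0.
elim: {NM0} M => [|M [m IH]].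
  by exists 1; apply: subv_trans L2N; apply: bracketvS; apply: subvf.
exists (m + r * M.+1)%N.
suff step j : (lower_central br J (m + j) <= rpow a j @: lcN M + lcN M.+1)%VS.
  apply: subv_trans (step _) _; rewrite subv_add subvv andbT.
  by apply/subvP => _ /memv_imgP[u uN ->]; apply: rpow_nilpotent_mod.
elim: j => [|j IHj].
  rewrite addn0; apply: subv_trans IH _; apply: subv_trans (addvSl _ _).
  by apply/subvP => u uN; rewrite -(rpow0 a u) memv_img.
rewrite addnS; apply/bracketvP => u v /(subvP IHj).
case/memv_addP=> _ /memv_imgP[w wN ->] [u2 u2N ->].
case/memv_addP=> n nN [_ /vlineP[c ->] ->].
rewrite brDl [X in X + _]brDr -addrA memvD //.
  by rewrite (subvP (addvSr _ _)) // memv_bracketv // rpow_lower_central.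
rewrite brZr -rpowS -linearZ memv_add ?memv_img ?memvZ //.
exact: lower_central_right.
Qed.

End Derivation.

Section Degree.
Variables (F : fieldType) (L : vectType F) (br : {bilinear L -> L -> L}).
Hypothesis hleib : right_leibniz br.
Variable N : {vspace L}.
Hypothesis idN : ideal br fullv N.
Local Notation lcN := (lower_central br N).
Variable h : L.
Hypothesis hdeg : {in N, forall u, br u h - u \in lcN 1}.

(** A derivation equal to 1 on N / N^2 is the degree derivation of the associated
    graded algebra: it is m + 1 on the quotient of lower_central N m, as the
    numbering starts at 0. *)
Lemma degree_lower_central m :
  {in lcN m, forall u, br u h - m.+1%:R *: u \in lcN m.+1}.
Proof.
elim: m => [|m IH] u uN; first by rewrite scale1r hdeg.
have fE v : (rmul br h - m.+2%:R *: \1%VF) v = br v h - m.+2%:R *: v.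
  by rewrite add_lfunE opp_lfunE scale_lfunE id_lfunE rmulE.
rewrite -fE; apply: span_lfun_sub uN => {u} u.
case/allpairsP=> -[v w] /= [/vbasis_mem vN /vbasis_mem wN ->]; rewrite fE hleib.
have -> : br (br v h) w + br v (br w h) - m.+2%:R *: br v w
  = br (br v h - m.+1%:R *: v) w + br v (br w h - w).
  rewrite brBl brBr brZl addrACA -opprD; congr (_ - _).
  by rewrite -addn1 natrD scalerDl scale1r.
rewrite memvD //; first by rewrite memv_bracketv ?IH.
by rewrite br_lower_central_sqr ?(ideal_subalgebra idN) // hdeg.
Qed.

End Degree.

(** * The torus *)

Lemma torus_free (F : fieldType) (L : vectType F) (br : {bilinear L -> L -> L})
    (K : nat) (E x : nat -> L) :
  (forall i j, (i < K)%N -> (j < K)%N -> br (E i) (x j) = (i == j)%:R *: E i) ->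
  free (mkseq E K) -> free (mkseq x K).
Proof.
move=> Ex freeE; apply: (free_mkseq_mod (U := 0%VS) _).1 => c.
rewrite memv0 => /eqP c0 i iK.
have : br (E i) (\sum_(j < K) c j *: x j) = c i *: E i.
  rewrite br_sumr (bigD1 (Ordinal iK)) //= big1 => [|j ji].
    by rewrite brZr Ex // eqxx scale1r addr0.
  rewrite brZr Ex // (_ : (i == j) = false) ?scale0r ?scaler0 //.
  by apply: contraNF ji => /eqP ij; apply/eqP/val_inj.
have EiE : E i \in mkseq E K by apply/mapP; exists i; rewrite ?mem_iota.
rewrite c0 br0r => /esym/eqP; rewrite scaler_eq0 => /orP[/eqP //|].
by rewrite (negPf (free_not0 freeE EiE)).
Qed.

Section Torus.
Variables (C : numClosedFieldType) (L : vectType C) (br : {bilinear L -> L -> L}).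
Hypotheses (hleib : right_leibniz br) (hsolv : solvable_alg br fullv).
Variables (N Q : {vspace L}).
Hypotheses (hN : nilradical br fullv N).
Hypotheses (hNQ : (N + Q)%VS = fullv) (hNQ0 : (N :&: Q)%VS = 0%VS).
Hypothesis hQdim : \dim Q = dim_abel br N.
Local Notation N2 := (bracketv br N N).
Local Notation K := (dim_abel br N).

Let idN : ideal br fullv N. Proof. by case: hN. Qed.
Let nilN : nilpotent_alg br N. Proof. by case: hN. Qed.
Let L2N : (bracketv br fullv fullv <= N)%VS.
Proof. exact: (@derived_sub_nilradical C L br hleib hsolv N hN). Qed.

Lemma br_in_nilradical u v : br u v \in N.
Proof. by apply: (subvP L2N); rewrite memv_bracketv ?memvf. Qed.

(** Otherwise the right multiplication could be adjoined to the maximal nilpotent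
    ideal N. *)
Lemma rpow_nilpotent_in a r :
  {in N, forall u, rpow br a r u \in lower_central br N 1} -> a \in N.
Proof.
move=> rN; have nilJ := nilpotent_adjoin hleib idN nilN L2N rN.
have: (N + <[a]> <= N)%VS.
  case: hN => _ _; apply=> //; apply: ideal_derived_sub.
  exact: subv_trans L2N (addvSl _ _).
by rewrite subv_add => /andP[_]; rewrite -memvE.
Qed.

(** An element of Q that is nilpotent on N / N^2 lies in N, hence is zero; so Q
    acts on N / N^2 as a commuting family of the largest possible dimension. *)
Lemma weight_basis_mod : exists (E : 'I_K -> L) (q : 'I_K -> L),
  [/\ forall i, E i \in N, forall j, q j \in Q,
      forall i j, br (E i) (q j) - (i == j)%:R *: E i \in N2,
      forall c : 'I_K -> C, \sum_i c i *: E i \in N2 -> forall i, c i = 0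
    & {in N, forall u, br u (\sum_j q j) - u \in N2}].
Proof.
have N2N : (N2 <= N)%VS := ideal_subalgebra idN.
pose V := (N :\: N2)%VS.
have dimV : \dim V = K.
  rewrite /dim_abel -(dimv_cap_compl N N2) (capv_idPr N2N) addKn //.
have [X basX] : exists X : K.-tuple L, basis_of V X.
  by rewrite -dimV; exists (vbasis V); apply: vbasisP.
have /andP[/eqP spanX freeX] := basX.
have capX : (<<X>> :&: N2 = 0)%VS by rewrite spanX capv_diff.
have defN : (<<X>> + N2)%VS = N.
  by rewrite spanX -[RHS](addv_diff_cap N N2) (capv_idPr N2N).
have Nr : {in (<<X>> + N2)%VS, forall w a, br w a \in (<<X>> + N2)%VS}.
  by rewrite defN => w wN a; apply: ideal_right.
have N2r : {in N2, forall u a, br u a \in N2}.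
  by move=> u uN a; apply: (lower_central_right hleib idN (m := 1)).
pose rho : {linear L -> 'M[C]_K} := rep_mod N2 X br.
pose kap : {linear L -> 'rV[C]_K} := coord_mod N2 X.
have kapE0 w : kap w = coord_mod N2 X w by [].
have rhoE a : rho a = rep_mod N2 X br a by [].
clearbody kap rho.
have kapE w a : w \in N -> kap (br w a) = kap w *m rho a.
  by move=> wN; rewrite !kapE0 rhoE; apply: coord_mod_br => //; rewrite defN.
have kap0 w : w \in N -> (kap w == 0) = (w \in N2).
  by move=> wN; rewrite kapE0; apply: coord_mod_eq0 => //; rewrite defN.
have XN i : X`_i \in N.
  have [iK|Ki] := ltnP i K; last by rewrite nth_default ?size_tuple ?mem0v.
  by rewrite (subvP (diffvSl N N2)) // (basis_mem basX) // mem_nth ?size_tuple.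
have rho0 a : a \in N -> rho a = 0.
  move=> aN; apply/row_matrixP => i; rewrite rhoE row_rep_mod row0; apply/eqP.
  by rewrite -kapE0 kap0 ?memv_bracketv ?ideal_right.
have [||V0 [Vu [q [qQ qP]]]] := @commuting_torus C L Q K rho _ hQdim.
- move=> a b aQ bQ; apply/eqP; rewrite -subr_eq0.
  have <- : rho (br a b) = rho a *m rho b - rho b *m rho a.
    by rewrite !rhoE; apply: (rep_modM capX hleib Nr N2r).
  by rewrite rho0 ?br_in_nilradical.
- move=> a aQ r ar0; have aN : a \in N.
    apply: (@rpow_nilpotent_in a r) => u uN.
    have rN j : rpow br a j u \in N by apply: (rpow_lower_central hleib idN (m := 0)).
    rewrite -kap0 //; suff -> : kap (rpow br a r u) = kap u *m rho a ^+ r.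
      by rewrite ar0 mulmx0.
    elim: (r) => [|j IHj]; first by rewrite rpow0 expr0 mulmx1.
    by rewrite rpowS kapE // IHj exprSr mulmxA.
  by apply/eqP; rewrite -memv0 -hNQ0 memv_cap aN.
pose E i := \sum_j V0 i j *: X`_j.
have EN i : E i \in N by apply: memv_suml => j _; rewrite memvZ.
have kapEi i : kap (E i) = row i V0.
  rewrite linear_sum; apply/rowP => j; rewrite summxE (bigD1 j) //= big1 => [|k kj].
    by rewrite linearZ /= kapE0 coord_modX // !mxE !eqxx mulr1 addr0.
  by rewrite linearZ /= kapE0 coord_modX // !mxE eq_sym (negPf kj) mulr0.
exists E, q; split=> // [i j|c cE i|u uN].
- rewrite -kap0 ?memvB ?memvZ ?ideal_right // linearB linearZ /=.
  rewrite kapE // kapEi qP.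
  by rewrite subrr.
- have: kap (\sum_i c i *: E i) == 0.
    by rewrite kap0 // memv_suml // => j _; rewrite memvZ.
  rewrite linear_sum /= => /eqP cV0; have cV : (\row_i c i) *m V0 = 0.
    rewrite -[RHS]cV0 mulmx_sum_row; apply: eq_bigr => j _.
    by rewrite linearZ kapEi mxE.
  have : \row_i c i = 0 by rewrite -(mulmxK Vu (\row_i c i)) cV mul0mx.
  by move/rowP/(_ i); rewrite !mxE.
- rewrite -kap0 ?memvB ?ideal_right // linearB /= kapE // subr_eq0.
  suff -> : rho (\sum_j q j) = 1%:M by rewrite mulmx1.
  apply: (can_inj (mulKmx Vu)); rewrite mulmx1; apply/row_matrixP => i.
  rewrite row_mul linear_sum mulmx_sumr (bigD1 i) //= qP eqxx scale1r.
  by rewrite big1 ?addr0 // => j ji; rewrite qP eq_sym (negPf ji) scale0r.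
Qed.

Lemma degree_ker0 h : {in N, forall u, br u h - u \in N2} ->
  {in N, forall u, br u h = 0 -> u = 0}.
Proof.
move=> hdeg u uN uh0; have [M NM0] := nilN.
apply/eqP; rewrite -memv0 -NM0; elim: {NM0} M => [|M IH]; first exact: uN.
have := degree_lower_central hleib idN hdeg IH; rewrite uh0 sub0r memvN.
move/(memvZ M.+1%:R^-1); rewrite scalerA mulVf ?scale1r //.
by rewrite pnatr_eq0.
Qed.

(** Let h be the sum of the basis q of Q dual to the weights of N / N^2. The right
    multiplication by h acts on the m-th quotient of the lower central series as the
    scalar m, hence is injective on N, and its kernel is an abelian subalgebra that
    complements N: it is the torus. Its elements x0 have the same weights on N / N^2 as
    the q. Their sum h' also has the eigenvalues 1, 2, .. on the lower central series,
    and the polynomial in h' that kills all eigenvalues except 1 commutes with the torus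
    and lifts weight vectors of N / N^2 to weight vectors of N. *)
Theorem torus_exists : exists E x : nat -> L,
  [/\ forall i, (i < K)%N -> E i \in N,
      forall i j, (i < K)%N -> (j < K)%N -> br (E i) (x j) = (i == j)%:R *: E i,
      forall i j, (i < K)%N -> (j < K)%N -> br (x i) (x j) = 0,
      basis_mod N N2 (mkseq E K)
    & (N + <<mkseq x K>>)%VS = fullv /\ (N :&: <<mkseq x K>> = 0)%VS].
Proof.
have [E0 [q [E0N qQ E0q E0free hdeg]]] := weight_basis_mod.
set h := \sum_j q j in hdeg.
pose T := lker (rmul br h).
have TP a : a \in T -> br a h = 0 by rewrite memv_ker rmulE => /eqP.
have NT0 : (N :&: T = 0)%VS.
  apply/eqP; rewrite -subv0; apply/subvP => u /memv_capP[uN /TP uh].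
  by rewrite memv0 (degree_ker0 hdeg uN uh).
have dimT : \dim T = K /\ (N + T = fullv)%VS.
  have dNT := dimv_disjoint_sum NT0.
  have dNQ := dimv_disjoint_sum hNQ0; rewrite hNQ hQdim in dNQ.
  have sub1 : (\dim {:L} - \dim N <= \dim T)%N.
    rewrite -(limg_ker_dim (rmul br h) fullv) capfv -/T leq_subLR addnC leq_add2r.
    by apply: dimvS; apply/subvP => _ /memv_imgP[u _ ->];
    rewrite rmulE br_in_nilradical.
  have sub2 : (\dim (N + T) <= \dim {:L})%N by rewrite dimvS ?subvf.
  have defT : \dim T = K.
    apply/eqP; rewrite eqn_leq -(leq_add2l (\dim N)) -dNT -dNQ sub2 /=.
    by rewrite -(addKn (\dim N) K) -dNQ.
  by split=> //; apply/eqP; rewrite eqEdim subvf dNT defT dNQ leqnn.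
have [{}dimT NT] := dimT.
have brT a b : a \in T -> b \in T -> br a b = 0.
  move=> /TP ah /TP bh; apply: (degree_ker0 hdeg); first exact: br_in_nilradical.
  by rewrite hleib ah bh br0l br0r addr0.
pose x0 j := daddv_pi T N (q j).
have x0T j : x0 j \in T by apply: memv_pi.
have x0q j : q j - x0 j \in N.
  have TN0 : (T :&: N = 0)%VS by rewrite capvC.
  have qTN : q j \in (T + N)%VS by rewrite addvC NT memvf.
  by rewrite -{1}(daddv_pi_add TN0 qTN) addrAC subrr add0r memv_pi.
have E0x i j : br (E0 i) (x0 j) - (i == j)%:R *: E0 i \in N2.
  rewrite -[x0 j](subKr (q j)) brBr addrAC memvB ?E0q //.
  by rewrite memv_bracketv // x0q.
pose h' := \sum_j x0 j.
have h'T : h' \in T by apply: memv_suml.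
have hdeg' : {in N, forall u, br u h' - u \in N2}.
  move=> u uN; have -> : h' = h - \sum_j (q j - x0 j) by rewrite sumrB subKr.
  rewrite brBr addrAC memvB ?hdeg // memv_bracketv // memv_suml //.
clearbody h'.
(* The product of the (ad h' - l) for 2 <= l <= m + 1. *)
pose P m : 'End(L) :=
  iteri m (fun l f => (rmul br h' - l.+2%:R *: \1%VF) \o f)%VF \1%VF.
have P0 u : P 0 u = u by rewrite id_lfunE.
have PS m u : P m.+1 u = br (P m u) h' - m.+2%:R *: P m u.
  by rewrite comp_lfunE add_lfunE opp_lfunE scale_lfunE id_lfunE rmulE.
clearbody P.
have Pkill m : {in N2, forall u, P m u \in lower_central br N m.+1}.
  elim: m => [|m IHm] u uN2; first by rewrite P0.
  by rewrite PS; apply: (degree_lower_central hleib idN hdeg' (m :=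
    m.+1)) (IHm _ uN2).
have Pcomm m a u : a \in T -> br (P m u) a = P m (br u a).
  move=> aT; elim: m => [|m IHm]; first by rewrite !P0.
  by rewrite !PS brBl brZl hleib IHm (brT h' a) // br0r addr0.
have [M NM0] := nilN.
have PM0 u : u \in N2 -> P M u = 0.
  by move/(Pkill M); rewrite /= NM0 bracketv0l memv0 => /eqP.
have [c [c0 Pc]] : exists c : C, c != 0 /\ {in N, forall u, P M u - c *: u \in N2}.
  elim: (M) => [|m [c [c0 Pc]]].
    by exists 1; rewrite oner_eq0; split=> // u uN; rewrite P0 scale1r subrr mem0v.
  exists (c * (1 - m.+2%:R)); split.
    by rewrite mulf_neq0 // subr_eq0 eq_sym pnatr_eq1.
  move=> u uN; set n := P m u - c *: u.
  have nN : n \in N2 := Pc u uN.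
  have -> : P m.+1 u - (c * (1 - m.+2%:R)) *: u
      = c *: (br u h' - u) + (br n h' - m.+2%:R *: n).
    have -> : P m.+1 u = c *: br u h' + br n h' - ((c * m.+2%:R) *: u + m.+2%:R *: n).
      rewrite PS -[P m u](subrK (c *: u)) -/n brDl brZl [n + _]addrC scalerDr scalerA.
      by rewrite [m.+2%:R * c]mulrC [br n _ + _]addrC.
    rewrite mulrBr mulr1 [(_ - _) *: u]scalerBl [c *: (_ - _)]scalerBr.
    rewrite opprD addrACA [LHS]addrAC; congr (_ + _).
    by rewrite opprB addrA subrK.
  rewrite memvD ?memvZ ?hdeg' //.
  by rewrite memvB ?memvZ //; apply: (lower_central_right hleib idN (m := 1)).
pose E1 i := c^-1 *: P M (E0 i).
have E1N2 i : E1 i - E0 i \in N2.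
  have -> : E1 i - E0 i = c^-1 *: (P M (E0 i) - c *: E0 i).
    by rewrite scalerBr scalerA mulVf // scale1r.
  by rewrite memvZ // Pc.
have E1N i : E1 i \in N.
  by rewrite -(subrK (E0 i) (E1 i)) memvD // (subvP (ideal_subalgebra idN)).
have E1x i j : br (E1 i) (x0 j) = (i == j)%:R *: E1 i.
  rewrite brZl Pcomm // -[br _ _](subrK ((i == j)%:R *: E0 i)) linearD /=.
  by rewrite PM0 // add0r linearZ /= !scalerA mulrC.
pose E := oapp E1 0 \o (insub : nat -> option 'I_K).
pose x := oapp x0 0 \o (insub : nat -> option 'I_K).
have EE (i : 'I_K) : E i = E1 i by rewrite /E /= valK.
have xE (i : 'I_K) : x i = x0 i by rewrite /x /= valK.
clearbody E x.
have E1free (k : nat -> C) : \sum_(i < K) k i *: E i \in N2 ->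
    forall i, (i < K)%N -> k i = 0.
  move=> kE i iK; apply: (E0free (fun i => k (val i)) _ (Ordinal iK)).
  have -> : \sum_(i < K) k i *: E0 i
      = \sum_(i < K) k i *: E i - \sum_(i < K) k i *: (E1 i - E0 i).
    rewrite -sumrB; apply: eq_bigr => l _; rewrite EE -scalerBr.
    by rewrite opprB addrC subrK.
  by rewrite memvB // memv_suml // => l _; rewrite memvZ.
have [freeE capE] := free_mkseq_mod E1free.
have EN i : (i < K)%N -> E i \in N by move=> iK; rewrite (EE (Ordinal iK)).
have Ex i j : (i < K)%N -> (j < K)%N -> br (E i) (x j) = (i == j)%:R *: E i.
  by move=> iK jK; rewrite (EE (Ordinal iK)) (xE (Ordinal jK)) E1x.
have xT j : (j < K)%N -> x j \in T by move=> jK; rewrite (xE (Ordinal jK)).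
have spanx : <<mkseq x K>>%VS = T.
  have freex : free (mkseq x K) := torus_free Ex freeE.
  apply/eqP; rewrite eqEdim span_mkseq_sub //= dimT.
  by rewrite (eqP freex) size_mkseq.
exists E, x; split=> //.
- by move=> i j iK jK; apply: brT; apply: xT.
- split=> //; apply/eqP; rewrite eqEdim subv_add span_mkseq_sub //=.
  rewrite ideal_subalgebra //= dimv_disjoint_sum // (eqP freeE) size_mkseq.
  by rewrite /dim_abel subnK // dimvS // ideal_subalgebra.
- by rewrite spanx.
Qed.

End Torus.

(** * Words and weights *)

Lemma span_sum (F : fieldType) (L : vectType F) (X : seq L) u :
  u \in <<X>>%VS -> exists2 vs : seq L, u = \sum_(v <- vs) v &
    {in vs, forall v, exists c, exists2 y, y \in X & v = c *: y}.
Proof.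
elim: X u => [|y X IH] u.
  by rewrite span_nil memv0 => /eqP ->; exists [::]; rewrite ?big_nil.
rewrite span_cons => /memv_addP[_ /vlineP[c ->] [u' /IH[vs -> vsX] ->]].
exists (c *: y :: vs); first by rewrite big_cons.
move=> v; rewrite inE => /predU1P[->|/vsX[c' [z zX ->]]].
  by exists c; exists y; rewrite ?mem_head.
by exists c'; exists z; rewrite // inE zX orbT.
Qed.

Section Words.
Variables (F : fieldType) (L : vectType F) (br : {bilinear L -> L -> L}).
Hypothesis hleib : right_leibniz br.
Variables (U : {vspace L}) (g : nat -> L) (k : nat).
Hypothesis sU : (bracketv br U U <= U)%VS.
Hypothesis gU : forall j, (j < k)%N -> g j \in U.

Lemma iter_bracket_lower_central w : w != [::] -> all (fun j => (j < k)%N) w ->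
  iter_bracket br g w \in lower_central br U (size w).-1.
Proof.
elim/last_ind: w => // w j IH _; rewrite all_rcons size_rcons => /andP[jk wk] /=.
have [->|w0] := eqVneq w [::]; first exact: gU.
rewrite iter_bracket_rcons //; case: w w0 wk IH => // i w _ wk IH.
by rewrite memv_bracketv ?gU // IH.
Qed.

Lemma bracketv_words : nilpotent_alg br U ->
  (U <= <<mkseq g k>> + bracketv br U U)%VS ->
  exists2 ws : seq (seq nat),
    {in ws, forall w, (1 < size w)%N && all (fun j => (j < k)%N) w} &
    bracketv br U U = <<map (iter_bracket br g) ws>>%VS.
Proof.
move=> nilU genU; have [M UM0] := nilU.
pose ws := [seq w <- flatten [seq wordsn k m | m <- iota 0 M.+2] | (1 < size w)%N].
have wsP w : (w \in ws) = [&& (1 < size w)%N, (size w < M.+2)%N & all (fun j =>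
  (j < k)%N) w].
  rewrite mem_filter; congr (_ && _); apply/flatten_mapP/andP => [[m]|[wM wk]].
    by rewrite mem_iota mem_wordsn => /= mM /andP[/eqP -> ->].
  by exists (size w); rewrite ?mem_iota // mem_wordsn eqxx.
exists ws => [w|]; first by rewrite wsP => /and3P[-> _ ->].
apply/eqP; rewrite eqEsubv; apply/andP; split.
  apply: (lower_central_sub_words (m := 1) hleib sU nilU genU) => w w1 wk.
  case: (ltnP (size w) M.+2) => wM.
    by apply/memv_span/map_f; rewrite wsP w1 wM wk.
  have: iter_bracket br g w \in lower_central br U M.
    apply: subvP (iter_bracket_lower_central _ wk); last by case: (w) w1.
    by apply: lower_central_leq => //; case: (size w) wM => // n /ltnW.
  by rewrite UM0 memv0 => /eqP ->; rewrite mem0v.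
apply/span_subvP => _ /mapP[w + ->]; rewrite wsP => /and3P[w1 _ wk].
apply: (subvP (lower_central_leq (m := 1) sU (_ : (1 <= (size w).-1)%N))).
  by case: (size w) w1.
by apply: iter_bracket_lower_central => //; case: (w) w1.
Qed.

End Words.

Lemma eq_iter_bracket (F : fieldType) (L : vectType F) (br : L -> L -> L)
    (g g' : nat -> L) k w :
  (forall j, (j < k)%N -> g j = g' j) -> all (fun j => (j < k)%N) w ->
  iter_bracket br g w = iter_bracket br g' w.
Proof.
move=> gg'; case: w => //= i w /andP[ik]; rewrite gg' //.
by elim: w (g' i) => //= j w IH u /andP[jk wk]; rewrite gg' // IH.
Qed.

Lemma iter_bracket_map (F : fieldType) (L : vectType F) (br : L -> L -> L)
    (g : nat -> L) (f : nat -> nat) w :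
  iter_bracket br (g \o f) w = iter_bracket br g (map f w).
Proof. by case: w => //= i w; elim: w (g (f i)) => //= j w IH u. Qed.

Section Weights.
Variables (C : numClosedFieldType) (L : vectType C) (br : {bilinear L -> L -> L}).
Hypothesis hleib : right_leibniz br.
Variables (K : nat) (x : nat -> L).

Definition weight_vector (a : nat -> nat) (v : L) : Prop :=
  forall j, (j < K)%N -> br v (x j) = (a j)%:R *: v.

Definition torus_stable (U : {vspace L}) : Prop :=
  forall j, (j < K)%N -> {in U, forall u, br u (x j) \in U}.

Definition weight_neq (a b : nat -> nat) : Prop := exists2 j, (j < K)%N & a j != b j.

Lemma weight_vectorZ a c v : weight_vector a v -> weight_vector a (c *: v).
Proof. by move=> av j jK; rewrite brZl av // !scalerA mulrC. Qed.

Lemma weight_vectorN a v : weight_vector a v -> weight_vector a (- v).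
Proof. by rewrite -scaleN1r; apply: weight_vectorZ. Qed.

Lemma weight_vector_eq a b v : a =1 b -> weight_vector a v -> weight_vector b v.
Proof. by move=> ab av j jK; rewrite -ab av. Qed.

Lemma weight_vector_iter_bracket (E : nat -> L) w :
  (forall i j, (i < K)%N -> (j < K)%N -> br (E i) (x j) = (i == j)%:R *: E i) ->
  w != [::] -> all (fun j => (j < K)%N) w ->
  weight_vector (fun j => count_mem j w) (iter_bracket br E w).
Proof.
move=> Ex; elim/last_ind: w => // w i IH _; rewrite all_rcons => /andP[iK wK] j jK.
have [->|w0] := eqVneq w [::]; first by rewrite /= Ex // addn0.
rewrite iter_bracket_rcons // hleib IH // Ex // brZl brZr -scalerDl -natrD.
by rewrite -cats1 count_cat /= addn0.
Qed.

(** Independence of weights modulo a stable subspace: operators ad x_j - a(j) kill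
    the v one by one, and multiply u by nonzero scalars modulo U. *)
Lemma weight_separation (U : {vspace L}) a0 u (vs : seq L) : torus_stable U ->
  (forall j, (j < K)%N -> br u (x j) - (a0 j)%:R *: u \in U) ->
  {in vs, forall v, exists2 a, weight_vector a v & weight_neq a a0} ->
  u - \sum_(v <- vs) v \in U -> u \in U.
Proof.
move=> stU; have [m] := ubnP (size vs); elim: m vs u => // m IH [|v vs] u /=.
  by rewrite big_nil subr0.
rewrite ltnS => sz uU vsP; rewrite big_cons => uvU.
have [a av [j jK aj]] := vsP v (mem_head _ _).
have cj : (a0 j)%:R - (a j)%:R != 0 :> C by rewrite subr_eq0 eqr_nat eq_sym.
pose D y := br y (x j) - (a j)%:R *: y.
suff: ((a0 j)%:R - (a j)%:R) *: u \in U.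
  by move/(memvZ ((a0 j)%:R - (a j)%:R)^-1); rewrite scalerA mulVf // scale1r.
apply: (IH [seq D y | y <- vs]).
- by rewrite size_map.
- move=> i iK; rewrite brZl scalerA mulrC -scalerA -scalerBr memvZ //; exact: uU.
- move=> _ /mapP[y yvs ->]; have [|b yb bj] := vsP y; first by rewrite inE yvs orbT.
  by exists b => //; rewrite /D yb // -scalerBl; apply: weight_vectorZ.
rewrite big_map.
have -> : ((a0 j)%:R - (a j)%:R) *: u - \sum_(y <- vs) D y
  = D (u - (v + \sum_(y <- vs) y)) - (br u (x j) - (a0 j)%:R *: u).
  rewrite /D !brBl brDl av // br_suml sumrB -scaler_sumr scalerBr scalerDr.
  rewrite scalerBl !opprD !opprK !addrA.
  by rewrite [RHS](ACl (8*4*3*6*(1*7)*(2*5))%AC) /= subrr addNr !addr0.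
by rewrite memvB ?uU // /D memvB ?memvZ ?stU.
Qed.

Variables (N : {vspace L}) (E : nat -> L).
Hypothesis idN : ideal br fullv N.
Hypothesis nilN : nilpotent_alg br N.
Local Notation N2 := (bracketv br N N).
Hypothesis EN : forall i, (i < K)%N -> E i \in N.
Hypothesis Ex : forall i j, (i < K)%N -> (j < K)%N ->
  br (E i) (x j) = (i == j)%:R *: E i.
Hypothesis baseE : basis_mod N N2 (mkseq E K).

Let N2N : (N2 <= N)%VS := ideal_subalgebra idN.
Let genN : (<<mkseq E K>> + N2 = N)%VS. Proof. by case: baseE. Qed.

Lemma weight_vector_gen i : (i < K)%N -> weight_vector (fun j => i == j) (E i).
Proof. by move=> iK j jK; rewrite Ex. Qed.

Lemma gen_coef_eq0 (c : nat -> C) : \sum_(i < K) c i *: E i \in N2 ->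
  forall i, (i < K)%N -> c i = 0.
Proof. by case: baseE => freeE _ capE; apply: free_mkseq_mod_eq0. Qed.

Lemma sqr_weight_decomposition u : u \in N2 ->
  exists2 vs : seq L, u = \sum_(v <- vs) v &
    {in vs, forall v, exists2 a : nat ->
      nat, weight_vector a v & (1 < \sum_(j < K) a j)%N}.
Proof.
have [|ws wsP ->] := bracketv_words hleib N2N EN nilN; first by rewrite genN.
case/span_sum => vs -> vsP; exists vs => // v /vsP[c [_ /mapP[w wws ->] ->]].
have /andP[w1 wK] := wsP w wws.
exists (fun j => count_mem j w).
  by apply/weight_vectorZ/weight_vector_iter_bracket => //; case: (w) w1.
suff -> : (\sum_(j < K) count_mem (j : nat) w = size w)%N by [].
elim: w wK {wws w1} => [|i w IH] /=; first by rewrite big1.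
case/andP=> iK wK; rewrite big_split /= IH // (bigD1 (Ordinal iK)) //= eqxx.
rewrite big1 ?addn0 ?add1n // => j ji.
by rewrite (_ : (i == j) = false) //; apply: contraNF ji => /eqP ij;
apply/eqP/val_inj.
Qed.

(** A total weight of at least 2 tells the weights of N^2 from those of the
    generators. *)
Lemma sqr_weight_neq (a : nat -> nat) i : (i < K)%N -> (1 < \sum_(j < K) a j)%N ->
  weight_neq a (fun j => i == j).
Proof.
move=> iK a1; case: (boolP [exists j : 'I_K, a j != (i == j)]) => [/existsP[j aj]|].
  by exists j.
rewrite negb_exists => /forallP aE; move: a1; rewrite (bigD1 (Ordinal iK)) //=.
have /negbNE/eqP -> := aE (Ordinal iK); rewrite eqxx big1 // => j ji.
have /negbNE/eqP -> := aE j; rewrite (_ : (i == j) = false) //.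
by apply: contraNF ji => /eqP ij; apply/eqP/val_inj.
Qed.

Lemma gen_weight_neq i l : (i < K)%N -> l != i ->
  weight_neq (fun j => l == j) (fun j => i == j).
Proof. by move=> iK li; exists i => //; rewrite eqxx (negPf li). Qed.

(** All the other weight vectors that span N have weights different from that of
    the i-th generator, so [weight_separation] removes them modulo U. *)
Lemma weight_space_gen (U : {vspace L}) i u : torus_stable U -> (i < K)%N ->
  u \in N ->
  (forall j, (j < K)%N -> br u (x j) - (i == j)%:R *: u \in U) ->
  exists c, u - c *: E i \in U.
Proof.
move=> stU iK; rewrite -{1}genN => /memv_addP[_ /span_mkseqP[c ->]].
move=> [n /sqr_weight_decomposition[vs defn vsP] ->] uU.
exists (c i); move def_u' : (_ - c i *: E i) => u'.
pose ws := [seq c l *: E l | l <- [seq l <- iota 0 K | l != i]] ++ vs.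
apply: (@weight_separation U (fun j => i == j) u' ws) => //.
- move=> j jK; have -> : br u' (x j) - (i == j)%:R *: u'
      = br (u' + c i *: E i) (x j) - (i == j)%:R *: (u' + c i *: E i).
    rewrite brDl scalerDr brZl Ex // !scalerA mulrC opprD addrACA subrr addr0 //.
  by rewrite -def_u' subrK; apply: uU.
- move=> v; rewrite mem_cat => /orP[/mapP[l + ->]|/vsP[a av a1]]; last first.
    by exists a => //; apply: sqr_weight_neq.
  rewrite mem_filter mem_iota => /andP[li lK].
  exists (fun j => l == j); last exact: gen_weight_neq.
  exact/weight_vectorZ/weight_vector_gen.
rewrite big_cat -defn big_map big_filter /= big_mkcond /=.
have -> : \sum_(l <- iota 0 K) (if l != i then c l *: E l else 0)
  = \sum_(l < K) (if (l : nat) != i then c l *: E l else 0).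
  by rewrite -{1}(subn0 K) -/(index_iota 0 K) big_mkord.
rewrite -def_u' addrAC (bigD1 (Ordinal iK)) //= [\sum_(l < K) _](bigD1 (Ordinal
  iK)) //=.
rewrite eqxx add0r; set S := \sum_(_ < _ | _) _; set S' := \sum_(_ < _ | _) _.
have -> : S' = S.
  by apply: eq_bigr => l; rewrite -val_eqE /= => ->.
by rewrite -[_ + S + n]addrA addrK subrr mem0v.
Qed.

(** A stable subspace contains the components of its elements along the
    generators, as their weights occur only once in N. *)
Lemma gen_component (U : {vspace L}) (c : nat -> C) n i : torus_stable U ->
  (i < K)%N -> n \in N2 ->
  \sum_(l < K) c l *: E l + n \in U -> c i *: E i \in U.
Proof.
move=> stU iK /sqr_weight_decomposition[vs -> vsP] uU.
pose ws := [seq - (c l *: E l) | l <- [seq l <- iota 0 K | l != i]] ++ map -%R vs.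
apply: (@weight_separation U (fun j => i == j) _ ws) => //.
- move=> j jK; rewrite brZl Ex // !scalerA mulrC subrr mem0v //.
- move=> v; rewrite mem_cat => /orP[/mapP[l + ->]|/mapP[y /vsP[a av a1] ->]];
last first.
    by exists a; [apply: weight_vectorN | apply: sqr_weight_neq].
  rewrite mem_filter mem_iota => /andP[li lK].
  exists (fun j => l == j); last exact: gen_weight_neq.
  exact/weight_vectorN/weight_vectorZ/weight_vector_gen.
rewrite big_cat !big_map big_filter /= !sumrN -opprD opprK addrA.
suff <- : \sum_(l < K) c l *: E l
  = c i *: E i + \sum_(l <- iota 0 K | l != i) c l *: E l by [].
rewrite (bigD1 (Ordinal iK)) //=; congr (_ + _).
rewrite big_mkcond [RHS]big_mkcond /=.
have -> : \sum_(l <- iota 0 K) (if l != i then c l *: E l else 0)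
  = \sum_(l < K) (if (l : nat) != i then c l *: E l else 0).
  by rewrite -{1}(subn0 K) -/(index_iota 0 K) big_mkord.
by apply: eq_bigr => l _; rewrite -val_eqE.
Qed.

End Weights.

(** * Direct decompositions of the nilradical *)

Section Decomposition.
Variables (F : fieldType) (L : vectType F) (br : {bilinear L -> L -> L}).
Hypothesis hleib : right_leibniz br.
Variable N : {vspace L}.
Hypothesis idN : ideal br fullv N.
Variables (I : finType) (B : I -> {vspace L}).
Hypothesis idB : forall i, ideal br N (B i).
Hypothesis sumB : (\sum_i B i)%VS = N.
Hypothesis dirB : directv (\sum_i B i).
Local Notation Z := (center br N).
Local Notation N2 := (bracketv br N N).

Definition component i : 'End(L) := daddv_pi (B i) (\sum_(j | j != i) B j).
Local Notation pi := component.

Let capB i : (B i :&: \sum_(j | j != i) B j = 0)%VS.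
Proof. exact: (directv_sumP dirB). Qed.

Let BN i : (B i <= N)%VS. Proof. by case: (idB i). Qed.

Lemma component_mem i u : pi i u \in B i. Proof. exact: memv_pi. Qed.

Lemma component_memN i u : pi i u \in N.
Proof. exact: subvP (BN i) _ (component_mem i u). Qed.

Lemma component_id i u : u \in B i -> pi i u = u.
Proof. by move=> uB; rewrite /pi daddv_pi_id. Qed.

Lemma component_neq i j u : j != i -> u \in B j -> pi i u = 0.
Proof.
move=> ji uB; have uW : u \in (\sum_(l | l != i) B l)%VS by apply: subvP (sumv_sup
  j ji (subvv _)) _ uB.
have := daddv_pi_add (capB i) (subvP (addvSr _ _) _ uW).
rewrite (daddv_pi_id (V := B i) _ uW); last by rewrite capvC.
by move/eqP; rewrite -subr_eq0 addrK => /eqP.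
Qed.

Lemma component_sum u : u \in N -> \sum_i pi i u = u.
Proof.
rewrite -{1}sumB => /memv_sumP[v vB ->]; apply: eq_bigr => i _.
rewrite linear_sum (bigD1 i) //= component_id ?vB // big1 ?addr0 // => j ji.
by rewrite (@component_neq i j) ?vB.
Qed.

Lemma br_cross i j u v : i != j -> u \in B i -> v \in B j -> br u v = 0.
Proof.
move=> ij uB vB; have [/idealP[_ ri li] /idealP[_ rj lj]] := (idB i, idB j).
have uvi : br u v \in B i by rewrite ri // (subvP (BN j)).
have uvj : br u v \in B j by rewrite lj // (subvP (BN i)).
by rewrite -(component_id uvi) (component_neq _ uvj) // eq_sym.
Qed.

Lemma br_component_r i u v : u \in B i -> v \in N -> br u v = br u (pi i v).
Proof.
move=> uB vN; rewrite -{1}(component_sum vN) br_sumr (bigD1 i) //= big1 ?addr0 //.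
by move=> j ji; rewrite (@br_cross i j) ?component_mem // eq_sym.
Qed.

Lemma br_component_l i u v : v \in B i -> u \in N -> br u v = br (pi i u) v.
Proof.
move=> vB uN; rewrite -{1}(component_sum uN) br_suml (bigD1 i) //= big1 ?addr0 //.
by move=> j ji; rewrite (@br_cross j i) ?component_mem.
Qed.

Lemma component_br i u v : u \in N -> v \in N -> pi i (br u v) = br (pi i u) (pi i v).
Proof.
move=> uN vN; rewrite -{1}(component_sum uN) br_suml linear_sum /=.
have pij j : pi i (br (pi j u) v) = if j == i then br (pi i u) (pi i v) else 0.
  have brj : br (pi j u) v \in B j.
    by have /idealP[_ h _] := idB j; rewrite h ?component_mem.
  have [ji|ji] := eqVneq j i; last by rewrite (component_neq ji).
  by rewrite -ji component_id // -br_component_r ?component_mem.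
by rewrite (eq_bigr _ (fun j _ => pij j)) -big_mkcond big_pred1_eq.
Qed.

Lemma component_sqr i u : u \in N2 -> pi i u \in bracketv br (B i) (B i).
Proof.
move=> uN; apply: span_lfun_sub uN => {u} u.
case/allpairsP=> -[v w] /= [/vbasis_mem vN /vbasis_mem wN ->].
by rewrite component_br // memv_bracketv ?component_mem.
Qed.

Lemma sqr_sub i : (bracketv br (B i) (B i) <= N2)%VS.
Proof. exact: bracketvS. Qed.

Lemma sqr_sub_component i : (bracketv br (B i) (B i) <= B i)%VS.
Proof.
apply/bracketvP => u v uB vB; have /idealP[_ h _] := idB i.
by rewrite h // (subvP (BN i)).
Qed.

Lemma component_center i z : z \in Z -> pi i z \in Z.
Proof.
case/centerP=> zN rz lz; apply/centerP; split=> [|u uN|u uN].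
- exact: component_memN.
- rewrite (br_component_r (component_mem i z) uN) -component_br // rz ?linear0 //.
- rewrite (br_component_l (component_mem i z) uN) -component_br // lz ?linear0 //.
Qed.

(** For u in one factor and v in another one, [u, v] = 0; differentiating this
    along x shows that the part of [u, x] outside the factor of u brackets to zero
    with everything. *)
Lemma component_cross_center i r u x : r != i -> u \in B r -> pi i (br u x) \in Z.
Proof.
move=> ri uB; have uN : u \in N := subvP (BN r) _ uB.
have brN : br u x \in N by apply: ideal_right.
have [/idealP[_ rr lr] /idealP[_ rri li]] := (idB r, idB i).
apply/centerP; split=> [|v vN|v vN]; first exact: component_memN.
- have p1 : br (pi i (br u x)) v \in B i by rewrite rri ?component_mem.
  suff p2 : br (pi i (br u x)) v \in B r.
    by rewrite -(component_id p1) (component_neq ri p2).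
  rewrite (br_component_r (component_mem i _) vN).
  rewrite -(br_component_l (component_mem i v) brN).
  have := hleib u (pi i v) x; rewrite (br_cross ri uB (component_mem i v)) br0l.
  move/esym/eqP; rewrite addr_eq0 => /eqP ->.
  by rewrite memvN rr // ideal_right // component_memN.
- have p1 : br v (pi i (br u x)) \in B i by rewrite li ?component_mem.
  suff p2 : br v (pi i (br u x)) \in B r.
    by rewrite -(component_id p1) (component_neq ri p2).
  rewrite (br_component_l (component_mem i _) vN).
  rewrite -(br_component_r (component_mem i v) brN).
  rewrite leibnizr // (br_cross _ (component_mem i v) uB) 1?eq_sym //.
  by rewrite br0l sub0r memvN lr // ideal_right // component_memN.
Qed.

Lemma component_defect_center i u x : u \in N -> br (pi i u) x - pi i (br u x) \in Z.
Proof.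
move=> uN; rewrite -{2}(component_sum uN) br_suml linear_sum (bigD1 i) //=.
rewrite opprD addrA memvB //; last first.
  by apply: memv_suml => r ri; apply: component_cross_center ri (component_mem r u).
have brN : br (pi i u) x \in N by apply: ideal_right => //; apply: component_memN.
rewrite -{1}(component_sum brN) (bigD1 i) //= addrAC subrr add0r memv_suml // => r ri.
by apply: component_cross_center (component_mem i u); rewrite eq_sym.
Qed.

End Decomposition.

Lemma center_torus_stable (F : fieldType) (L : vectType F)
    (br : {bilinear L -> L -> L}) (N : {vspace L}) : right_leibniz br ->
  ideal br fullv N -> {in center br N, forall z x, br z x \in center br N}.
Proof.
move=> hleib idN z /centerP[zN rz lz] x; apply/centerP; split=> [|u uN|u uN].
- exact: ideal_right.
- have := hleib z u x; rewrite (rz u) // br0l (rz (br u x)) ?addr0 //.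
  exact: ideal_right.
- have := hleib u z x; rewrite (lz u) // br0l (lz (br u x)) ?add0r //.
  exact: ideal_right.
Qed.

(** * Graded bases *)

(** The data of the theorem, indexed uniformly by the nonabelian factors and the
    abelian one, o. For t = o the bases e and y are the f and y of the theorem, and
    k o = n o there. The function coef turns an element of the square of a factor into its
    coordinates on the words. *)
Record graded_basis (C : numClosedFieldType) (L : vectType C) (br : L -> L -> L)
    (I : finType) (o : I) (T : {vspace L}) (M : I -> {vspace L}) (n k k1 : I -> nat)
    (e y : I -> nat -> L) (w : I -> nat -> seq nat) (coef : I -> L -> nat -> C)
    (sqrM := fun t => bracketv br (M t) (M t))
    (R := fun t => (M t + <<mkseq (y t) (k t)>>)%VS)
    (same := fun t i r =>
      [forall l : 'I_(k t), count_mem (l : nat) (w t i) == count_mem (l : nat) (w t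
        r)])
    : Prop := GradedBasis {
  gb_basis : forall t, basis_of (M t) (mkseq (e t) (n t));
  gb_gens : forall t, basis_mod (M t) (sqrM t) (mkseq (e t) (k t));
  gb_k1 : forall t, (k1 t <= k t)%N;
  gb_notin_annr : forall t i, t != o -> (i < k1 t)%N -> ~ annr br (M t) (e t i);
  gb_in_annr : forall t i, (k1 t <= i < k t)%N -> annr br (M t) (e t i);
  gb_sqr : forall t i, (k t <= i < n t)%N -> e t i \in sqrM t;
  gb_words : forall t i, (k t <= i < n t)%N ->
    [/\ (2 <= size (w t i))%N, all (fun j => (j < k t)%N) (w t i)
      & e t i = iter_bracket br (e t) (w t i)];
  gb_tor_mem : forall t j, (j < k t)%N -> y t j \in T;
  gb_tor_span : forall U : {vspace L},
    (forall t j, (j < k t)%N -> y t j \in U) -> (T <= U)%VS;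
  gb_ee_cross : forall t t' i j, t != t' -> (i < n t)%N -> (j < n t')%N ->
    br (e t i) (e t' j) = 0;
  gb_ey_cross : forall t t' i j, t != t' -> (i < n t)%N -> (j < k t')%N ->
    br (e t i) (y t' j) = 0;
  gb_ye_cross : forall t t' i j, t != t' -> (i < n t)%N -> (j < k t')%N ->
    br (y t' j) (e t i) = 0;
  gb_yy : forall t t' i j, (i < k t)%N -> (j < k t')%N -> br (y t i) (y t' j) = 0;
  gb_ee : forall t i j, (i < n t)%N -> (j < n t)%N ->
    br (e t i) (e t j) = \sum_(k t <= r < n t) coef t (br (e t i) (e t j)) r *: e t r;
  gb_ey_gen : forall t i j, (i < k t)%N -> (j < k t)%N ->
    br (e t i) (y t j) = if i == j then e t i else 0;
  gb_ey_word : forall t i j, (k t <= i < n t)%N -> (j < k t)%N ->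
    br (e t i) (y t j) = (count_mem j (w t i))%:R *: e t i;
  gb_ye_gen : forall t i j, (i < k t)%N -> (j < k t)%N ->
    br (y t j) (e t i) = if (i == j) && (i < k1 t)%N then - e t i else 0;
  gb_ye_word : forall t i j, (k t <= i < n t)%N -> (j < k t)%N ->
    br (y t j) (e t i) =
      \sum_(k t <= r < n t | same t i r) coef t (br (y t j) (e t i)) r *: e t r;
  gb_ideal : forall t, ideal br fullv (R t);
  gb_cap : forall t, (M t :&: <<mkseq (y t) (k t)>> = 0)%VS;
  gb_nilradical : forall t, nilradical br (R t) (M t);
  gb_solvable : forall t, abelian_alg br (M t) -> solvable_alg br (R t);
  gb_sum : (\sum_t R t)%VS = fullv;
  gb_dim_sum : (\sum_t \dim (R t) <= \dim {:L})%N;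
  gb_dim : \dim {:L} = (\sum_t (n t + k t))%N
}.

(** * A decomposition compatible with the torus *)

Section Splitting.
Variables (C : numClosedFieldType) (L : vectType C) (br : {bilinear L -> L -> L}).
Hypothesis hleib : right_leibniz br.
Variables (K : nat) (N : {vspace L}) (E x : nat -> L).
Hypothesis idN : ideal br fullv N.
Hypothesis nilN : nilpotent_alg br N.
Hypothesis brN : forall u v, br u v \in N.
Local Notation N2 := (bracketv br N N).
Local Notation Z := (center br N).
Local Notation T := <<mkseq x K>>%VS.
Hypothesis EN : forall i, (i < K)%N -> E i \in N.
Hypothesis Ex : forall i j, (i < K)%N -> (j < K)%N ->
  br (E i) (x j) = (i == j)%:R *: E i.
Hypothesis xx : forall i j, (i < K)%N -> (j < K)%N -> br (x i) (x j) = 0.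
Hypothesis baseE : basis_mod N N2 (mkseq E K).
Hypotheses (NT : (N + T)%VS = fullv) (NT0 : (N :&: T = 0)%VS).
Variables (I : finType) (o : I) (B : I -> {vspace L}).
Hypothesis idB : forall i, ideal br N (B i).
Hypothesis sumB : (\sum_i B i)%VS = N.
Hypothesis dirB : directv (\sum_i B i).
Hypothesis abelB : abelian_alg br (B o).
Hypothesis centerB : forall i, i != o -> (Z :&: B i <= bracketv br (B i) (B i))%VS.
Local Notation pi := (component B).

Let N2N : (N2 <= N)%VS := ideal_subalgebra idN.
Let ZN : (Z <= N)%VS. Proof. by apply/subvP => z /centerP[]. Qed.
Let stZ : torus_stable br K x Z.
Proof. by move=> j _ z zZ; apply: center_torus_stable. Qed.
Let BN i : (B i <= N)%VS. Proof. by case: (idB i). Qed.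

Let BoZ : (B o <= Z)%VS.
Proof.
have brBo : {in B o &, forall u v, br u v = 0}.
  by move=> u v uB vB; apply/eqP; rewrite -memv0 -abelB memv_bracketv.
apply/subvP => u uB; apply/centerP; split=> [|v vN|v vN].
- exact: subvP (BN o) _ uB.
- by rewrite (br_component_r idB sumB dirB uB vN) brBo ?component_mem.
- by rewrite (br_component_l idB sumB dirB uB vN) brBo ?component_mem.
Qed.

(** Modulo the center, the projections commute with the torus, so they preserve
    its weight spaces. *)
Lemma component_gen i t : (i < K)%N -> exists c, pi t (E i) - c *: E i \in Z.
Proof.
move=> iK; apply: (weight_space_gen hleib idN nilN EN Ex baseE) => //.
  exact: component_memN idB _ _.
move=> j jK; rewrite -linearZ -Ex //.
exact: (component_defect_center hleib idN idB sumB dirB t (x j) (EN iK)).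
Qed.

(** The factor projections are idempotents that act on a generator, modulo the
    center, by scalars with sum 1; outside the center, one of these scalars is 1. *)
Lemma component_gen_exists i : (i < K)%N -> E i \notin Z ->
  exists t, (t != o) && (pi t (E i) - E i \in Z).
Proof.
move=> iK iZ.
have cP t c : pi t (E i) - c *: E i \in Z -> c = 0 \/ c = 1.
  move=> cZ; have := component_center idB sumB dirB t cZ.
  rewrite linearB linearZ /= (component_id dirB (component_mem B t _)).
  set u := pi t (E i) in cZ *; move=> uZ.
  have : (c * (1 - c)) *: E i \in Z.
    have -> : (c * (1 - c)) *: E i = (1 - c) *: u - (1 - c) *: (u - c *: E i).
      by rewrite -scalerBr subKr scalerA mulrC.
    by apply: memvB; [rewrite scalerBl scale1r | rewrite memvZ].
  have [/eqP|c0] := eqVneq (c * (1 - c)) 0.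
    by rewrite mulf_eq0 subr_eq0 => /orP[/eqP|/eqP]; [left | right].
  by move/(memvZ (c * (1 - c))^-1); rewrite scalerA mulVf // scale1r (negPf iZ).
case: (boolP [exists t, (t != o) && (pi t (E i) - E i \in Z)]) => [/existsP //|].
rewrite negb_exists => /forallP nt; case/negP: iZ.
rewrite -(component_sum sumB dirB (EN iK)); apply: memv_suml => t _.
have [->|to] := eqVneq t o; first exact: subvP BoZ _ (component_mem B o _).
have [c cZ] := component_gen t iK; have [c0|c1] := cP t c cZ.
  by move: cZ; rewrite c0 scale0r subr0.
by move: (nt t) cZ; rewrite to c1 scale1r => /negP.
Qed.

(** The central generators are assigned to the abelian factor o. *)
Definition factor_of i : I :=
  if E i \in Z then o
  else odflt o [pick t | (t != o) && (pi t (E i) - E i \in Z)].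
Local Notation tau := factor_of.

Lemma factor_of_center i : (i < K)%N -> (tau i == o) = (E i \in Z).
Proof.
move=> iK; rewrite /tau; case: ifPn => [_|iZ]; first exact: eqxx.
case: pickP => [t /andP[/negPf //]|nt].
by have [t] := component_gen_exists iK iZ; rewrite nt.
Qed.

Lemma component_factor_of i : (i < K)%N -> pi (tau i) (E i) - E i \in Z.
Proof.
move=> iK; rewrite /tau; case: ifPn => [iZ|iZ].
  by rewrite memvB // (subvP BoZ) ?component_mem.
case: pickP => [t /andP[]//|nt].
by have [t] := component_gen_exists iK iZ; rewrite nt.
Qed.

(** The center is stable under the torus, so it contains the generators that
    occur in its elements. *)
Lemma center_gen z : z \in Z -> exists c : nat -> C,
  z - \sum_(i < K | E i \in Z) c i *: E i \in N2.
Proof.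
move=> zZ; have : z \in (<<mkseq E K>> + N2)%VS by case: baseE => _ -> _;
apply: subvP zZ.
case/memv_addP => _ /span_mkseqP[c ->] [n nN def_z]; exists c.
rewrite [in X in X \in _]def_z (bigID (fun i : 'I_K =>
  E i \in Z)) /= addrAC [X in X - _]addrC addrK.
rewrite memvD // memv_suml // => i iZ.
rewrite def_z in zZ; have : c i *: E i \in Z.
  exact: (gen_component hleib idN nilN EN Ex baseE stZ (ltn_ord i) nN).
have [->|c0] := eqVneq (c i) 0; first by rewrite scale0r !mem0v.
by move/(memvZ (c i)^-1); rewrite scalerA mulVf // scale1r (negPf iZ).
Qed.

(** The automorphism is the inverse of the map psi that projects every generator
    onto its own factor and fixes N^2 and the torus. As psi changes vectors by central
    elements only, it preserves brackets. A vector v of its kernel is central, hence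
    v = m + n with m a combination of central generators and n in N^2, and
    psi v = pi o m + n = 0 forces n = 0 and pi o m = 0, as B o meets N^2 trivially; then m
    lies in the other factors, whose central elements lie in N^2, so that m = 0. *)
Lemma twist_exists : exists phi : 'End(L),
  [/\ lker phi == 0%VS, {in N2, forall u, phi u = u},
      forall i, (i < K)%N -> phi (pi (tau i) (E i)) = E i, (phi @: N)%VS = N
    & {in N &, forall u v, br (phi u) (phi v) = br u v}].
Proof.
pose W := (N2 + T)%VS.
have capW : (<<mkseq E K>> :&: W = 0)%VS.
  apply/eqP; rewrite -subv0; apply/subvP => u /memv_capP[uE].
  case/memv_addP=> n nN [t tT def_u].
  have /span_mkseqP[c def_c] := uE.
  have tN : t \in (N :&: T)%VS.
    rewrite memv_cap tT andbT -(addKr n t) addrC -def_u memvB //.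
      by rewrite def_c memv_suml // => i _; rewrite memvZ ?EN.
    exact: (subvP N2N).
  move: tN def_u; rewrite NT0 memv0 => /eqP->; rewrite addr0 => un.
  by case: baseE => _ _ <-; rewrite memv_cap uE un.
have freeE : free (mkseq E K) by case: baseE.
pose X : K.-tuple L := Tuple (introT eqP (size_mkseq E K)).
have capX : (<<X>> :&: W = 0)%VS by [].
have XE (i : 'I_K) : X`_i = E i by rewrite nth_mkseq.
pose kap : {linear L -> 'rV[C]_K} := coord_mod W X.
have kapE (i : 'I_K) : kap (E i) = delta_mx 0 i.
  by rewrite -XE; apply: coord_modX.
have kapW u : u \in W -> kap u = 0.
  move=> uW; apply/eqP; rewrite -[kap _]/(coord_mod W X u).
  by rewrite (coord_mod_eq0 capX) // (subvP (addvSr _ _)).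
clearbody kap; clear X capX XE.
pose d (i : 'I_K) := pi (tau i) (E i) - E i.
pose nu (v : L) := \sum_i kap v 0 i *: d i.
have nu_lin : linear nu.
  move=> c u v; rewrite scaler_sumr -big_split; apply: eq_bigr => i _ /=.
  by rewrite linearP !mxE scalerDl scalerA.
pose nuM := GRing.isLinear.Build _ _ _ _ nu nu_lin.
pose nuL : {linear L -> L} := HB.pack nu nuM.
have nuZ v : nu v \in Z.
  by apply: memv_suml => i _; rewrite memvZ // component_factor_of.
have nuW u : u \in W -> nu u = 0.
  by move=> uW; apply: big1 => i _; rewrite kapW // mxE scale0r.
have nuE (i : 'I_K) : nu (E i) = d i.
  rewrite /nu (bigD1 i) //= kapE !mxE !eqxx scale1r big1 ?addr0 // => j ji.
  by rewrite mxE (negPf ji) andbF scale0r.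
pose psi : 'End(L) := (\1 + linfun nuL)%VF.
have psiE v : psi v = v + nu v by rewrite add_lfunE id_lfunE lfunE.
have N2W : (N2 <= W)%VS := addvSl _ _.
clearbody psi; clear nuL nuM nu_lin; clearbody nu.
have psiN2 u : u \in N2 -> psi u = u.
  by move=> uN; rewrite psiE nuW ?addr0 // (subvP N2W).
have piN2 u : u \in N2 -> pi o u = 0.
  by move/(component_sqr idB sumB dirB o); rewrite abelB memv0 => /eqP.
have psi_inj : lker psi == 0%VS.
  rewrite -subv0; apply/subvP => v; rewrite memv_ker psiE addr_eq0 => /eqP def_v.
  have vZ : v \in Z by rewrite def_v memvN.
  have [c] := center_gen vZ; move def_m : (\sum_(i < K | _) _) => m.
  move def_n : (v - m) => n nN.
  have mZ : m \in Z by rewrite -def_m; apply: memv_suml => i iZ; rewrite memvZ.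
  have v_mn : v = m + n by rewrite -def_n addrC subrK.
  have psim : psi m = pi o m.
    rewrite -def_m !linear_sum; apply: eq_bigr => i iZ; rewrite !linearZ;
    congr (_ *: _).
    have /eqP tau_o : tau i == o by rewrite factor_of_center.
    by rewrite /= psiE nuE /d tau_o addrC subrK.
  have psiv0 : psi v = 0 by rewrite psiE {1}def_v addNr.
  have pmn : pi o m + n = 0 by rewrite -psiv0 v_mn linearD /= psim (psiN2 n).
  have pm0 : pi o m = 0.
    have := congr1 (pi o) pmn; rewrite linearD /= linear0 (piN2 n) // addr0.
    by rewrite (component_id dirB (component_mem B o m)).
  have n0 : n = 0 by move: pmn; rewrite pm0 add0r.
  suff mN2 : m \in N2.
    have m_sum : m = \sum_(i < K) (if E i \in Z then c i else 0) *: E i.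
      rewrite -def_m big_mkcond; apply: eq_bigr => i _.
      by case: ifP => // _; rewrite scale0r.
    rewrite memv0 v_mn n0 addr0 m_sum big1 // => i _.
    rewrite m_sum in mN2.
    by rewrite (gen_coef_eq0 baseE (c := fun i =>
      if E i \in Z then c i else 0) mN2) ?scale0r.
  rewrite -(component_sum sumB dirB (subvP ZN _ mZ)); apply: memv_suml => t _.
  have [->|to] := eqVneq t o; first by rewrite pm0 mem0v.
  apply: (subvP (sqr_sub idB t)); apply: (subvP (centerB to)).
  by rewrite memv_cap component_center // component_mem.
have psiN : (psi @: N)%VS = N.
  apply/eqP; rewrite eqEdim limg_dim_eq ?leqnn ?andbT.
    by apply/subvP => _ /memv_imgP[u uN ->]; rewrite psiE memvD // (subvP ZN).
  by rewrite (eqP psi_inj) capv0.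
have psi_br : {in N &, forall u v, br (psi u) (psi v) = br u v}.
  move=> u v uN vN; have [/centerP[_ rz _] /centerP[zN _ lz]] := (nuZ u, nuZ v).
  rewrite !psiE brDl [br (nu u) _]rz ?addr0 ?memvD //.
  by rewrite brDr lz ?addr0.
have psiK := lker0_lfunK psi_inj; have psiVK := lker0_lfunVK psi_inj.
exists (psi^-1)%VF; split.
- apply/lker0P => u v uv.
  by rewrite -(psiVK u) uv psiVK.
- by move=> u uN; rewrite -{1}(psiN2 u uN) psiK.
- move=> i iK; rewrite -[RHS]psiK psiE (nuE (Ordinal iK)) /d /=.
  by rewrite addrC subrK.
- rewrite -{1}psiN -limg_comp; apply/vspaceP => u; apply/memv_imgP/idP.
    by case=> v vN ->; rewrite comp_lfunE psiK.
  by move=> uN; exists u; rewrite // comp_lfunE psiK.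
- move=> u v; rewrite -{1 2}psiN => /memv_imgP[a aN ->] /memv_imgP[b bN ->].
  by rewrite !psiK psi_br.
Qed.

(** The torus is abelian, so its left action preserves weights, and the weight
    of a generator has multiplicity one. *)
Lemma left_gen i j : (i < K)%N -> (j < K)%N -> exists c, br (x j) (E i) = c *: E i.
Proof.
move=> iK jK; have [|l lK|c] :=
  @weight_space_gen C L br hleib K x N E idN nilN EN Ex baseE 0%VS i (br (x j) (E
    i)) _ iK (brN _ _).
- by move=> l _ u; rewrite memv0 => /eqP->; rewrite br0l mem0v.
- by rewrite hleib xx // br0l add0r Ex // brZr subrr mem0v.
by rewrite memv0 subr_eq0 => /eqP->; exists c.
Qed.

(** The symmetrized bracket [E_i, x_j] + [x_j, E_i] is a multiple of E_i that is
    killed by the left multiplication by x_i, which does not kill E_i; so the multiple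
    is zero. *)
Lemma left_gen_dichotomy i : (i < K)%N -> br (x i) (E i) != 0 ->
  forall j, (j < K)%N -> br (x j) (E i) = - ((i == j)%:R *: E i).
Proof.
move=> iK xEi j jK; have [c xEj] := left_gen iK jK.
have := br_sym0 hleib (x i) (E i) (x j); rewrite Ex // xEj -scalerDl brZr.
move/eqP; rewrite scaler_eq0 (negPf xEi) orbF addrC addr_eq0 => /eqP ->.
by rewrite scaleNr.
Qed.

Lemma left_gen_annr i : (i < K)%N -> br (x i) (E i) = 0 -> forall y, br y (E i) = 0.
Proof.
move=> iK xEi y; have := br_sym0 hleib y (E i) (x i).
by rewrite Ex // eqxx scale1r xEi addr0.
Qed.

(** If E_i annihilates N on the right, then [E_i, u] is a symmetrized bracket;
    the left multiplication by x_i kills it, but also multiplies it by -1. *)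
Lemma annr_gen_center i : (i < K)%N -> br (x i) (E i) != 0 ->
  {in N, forall u, br u (E i) = 0} -> E i \in Z.
Proof.
move=> iK xEi annE; apply/centerP; split=> // [|u uN]; first exact: EN.
have := br_sym0 hleib (x i) (E i) u; rewrite annE // addr0 leibnizr //.
rewrite (annE (br (x i) u)) // subr0 (left_gen_dichotomy iK xEi iK) eqxx scale1r.
by rewrite brNl => /eqP; rewrite oppr_eq0 => /eqP.
Qed.

Section Twisted.
Variable phi : 'End(L).
Hypothesis phi_inj : lker phi == 0%VS.
Hypothesis phiN2 : {in N2, forall u, phi u = u}.
Hypothesis phi_gen : forall i, (i < K)%N -> phi (pi (tau i) (E i)) = E i.
Hypothesis phiN : (phi @: N)%VS = N.
Hypothesis phi_br : {in N &, forall u v, br (phi u) (phi v) = br u v}.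
Local Notation M i := (phi @: B i)%VS.
Local Notation sqrM i := (bracketv br (M i) (M i)).

Lemma twisted_automorphism : automorphism br N phi.
Proof.
split=> // u v uN vN; rewrite phi_br //; apply: phiN2; exact: memv_bracketv.
Qed.

Lemma twisted_sub i : (M i <= N)%VS.
Proof. by rewrite -phiN limgS. Qed.

Lemma twisted_dim i : \dim (M i) = \dim (B i).
Proof. by rewrite limg_dim_eq // (eqP phi_inj) capv0. Qed.

Lemma twisted_sum : (\sum_i M i)%VS = N.
Proof. by rewrite -limg_sum sumB. Qed.

Lemma twisted_direct : directv (\sum_i M i).
Proof.
rewrite directvE /= twisted_sum -sumB (directvP dirB) /=.
by apply/eqP/eq_bigr => i _; rewrite twisted_dim.
Qed.

Lemma twisted_sqr i : sqrM i = bracketv br (B i) (B i).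
Proof.
apply/eqP; rewrite eqEsubv; apply/andP; split; apply/bracketvP => u v.
  move=> /memv_imgP[a aB ->] /memv_imgP[b bB ->].
  by rewrite phi_br ?(subvP (BN i)) // memv_bracketv.
by move=> uB vB; rewrite -phi_br ?(subvP (BN i)) // memv_bracketv ?memv_img.
Qed.

Lemma twisted_sqr_sub i : (sqrM i <= M i)%VS.
Proof.
rewrite twisted_sqr; apply/subvP => u uB.
rewrite -(phiN2 (subvP (sqr_sub idB i) _ uB)) memv_img //.
exact: subvP (sqr_sub_component idB i) _ uB.
Qed.

Lemma twisted_cross i j u v : i != j -> u \in M i -> v \in M j -> br u v = 0.
Proof.
move=> ij /memv_imgP[a aB ->] /memv_imgP[b bB ->].
rewrite phi_br; [exact: (br_cross idB dirB ij) | exact: subvP aB | exact: subvP bB].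
Qed.

Lemma twisted_br_r i u v : u \in M i -> v \in N -> br u v \in sqrM i.
Proof.
move=> uM; rewrite -twisted_sum => /memv_sumP[w wM ->].
rewrite br_sumr (bigD1 i) //= big1 ?addr0 ?memv_bracketv ?wM // => j ji.
by rewrite (@twisted_cross i j) ?wM // eq_sym.
Qed.

Lemma twisted_br_l i u v : u \in M i -> v \in N -> br v u \in sqrM i.
Proof.
move=> uM; rewrite -twisted_sum => /memv_sumP[w wM ->].
rewrite br_suml (bigD1 i) //= big1 ?addr0 ?memv_bracketv ?wM // => j ji.
by rewrite (@twisted_cross j i) ?wM.
Qed.

Lemma gen_twisted i : (i < K)%N -> E i \in M (tau i).
Proof. by move=> iK; rewrite -(phi_gen iK) memv_img // component_mem. Qed.

Definition factor_gens t := [seq i <- iota 0 K | tau i == t].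

Lemma mem_factor_gens t i : (i \in factor_gens t) = (tau i == t) && (i < K)%N.
Proof. by rewrite mem_filter mem_iota. Qed.

(** The right-hand sides lie in the factors M t and add up to N, and the sum of
    the M t is direct. *)
Lemma twisted_generated t : M t = (<<map E (factor_gens t)>> + sqrM t)%VS.
Proof.
pose M' r := (<<map E (factor_gens r)>> + sqrM r)%VS.
have M'M r : (M' r <= M r)%VS.
  rewrite subv_add twisted_sqr_sub andbT; apply/span_subvP => _ /mapP[i + ->].
  by rewrite mem_factor_gens => /andP[/eqP <- iK]; apply: gen_twisted.
apply/eqP; rewrite eqEsubv M'M andbT; apply/subvP => u uM.
have : u \in (\sum_r M' r)%VS.
  apply: (subvP (_ : N <= _)%VS); last exact: subvP (twisted_sub t) _ uM.
  case: baseE => _ <- _; rewrite subv_add; apply/andP; split.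
    apply: span_mkseq_sub => i iK; apply: (subvP (sumv_sup (tau i) isT (subvv _))).
    by rewrite (subvP (addvSl _ _)) // memv_span // map_f // mem_factor_gens eqxx.
  apply/bracketvP => v w vN wN; rewrite -(component_sum sumB dirB vN) br_suml.
  apply: memv_suml => r _; apply: (subvP (sumv_sup r isT (subvv _))).
  rewrite (subvP (addvSr _ _)) // twisted_sqr.
  by rewrite (br_component_r idB sumB dirB (component_mem B r v)) // memv_bracketv
    ?component_mem.
case/memv_sumP => w wM' def_u.
have := component_id twisted_direct uM; rewrite def_u linear_sum (bigD1 t) //=.
rewrite (component_id twisted_direct) ?(subvP (M'M _)) ?wM' // big1 => [|r rt].
  by rewrite addr0 => <-; apply: wM'.
by rewrite (component_neq twisted_direct rt) // (subvP (M'M _)) ?wM'.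
Qed.

Lemma twisted_torus_r t j u : (j < K)%N -> u \in M t -> br u (x j) \in M t.
Proof.
move=> jK; rewrite {1}twisted_generated => /memv_addP[v vE [w wM ->]].
rewrite brDl memvD //.
  rewrite -rmulE; apply: span_lfun_sub vE => {v} _ /mapP[i + ->].
  rewrite mem_factor_gens rmulE => /andP[/eqP <- iK].
  by rewrite Ex // memvZ // gen_twisted.
apply: (subvP (twisted_sqr_sub t)); rewrite -rmulE.
apply: span_lfun_sub wM => {w} w;
case/allpairsP=> -[a b] /= [/vbasis_mem aM /vbasis_mem bM ->].
by rewrite rmulE hleib; apply: memvD; [apply: twisted_br_l | apply: twisted_br_r].
Qed.

Lemma twisted_torus_l t j u : (j < K)%N -> u \in M t -> br (x j) u \in M t.
Proof.
move=> jK; rewrite {1}twisted_generated => /memv_addP[v vE [w wM ->]].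
rewrite brDr memvD //.
  rewrite -lmulE; apply: span_lfun_sub vE => {v} _ /mapP[i + ->].
  rewrite mem_factor_gens lmulE => /andP[/eqP <- iK].
  by have [c ->] := left_gen iK jK; rewrite memvZ // gen_twisted.
apply: (subvP (twisted_sqr_sub t)); rewrite -lmulE.
apply: span_lfun_sub wM => {w} w;
case/allpairsP=> -[a b] /= [/vbasis_mem aM /vbasis_mem bM ->].
by rewrite lmulE leibnizr //; apply: memvB; apply: twisted_br_l.
Qed.

Lemma twisted_ideal t : ideal br fullv (M t).
Proof.
have Tr u v : u \in M t -> v \in T -> br u v \in M t /\ br v u \in M t.
  move=> uM /span_mkseqP[c ->]; rewrite br_sumr br_suml; split;
  apply: memv_suml => j _.
    by rewrite brZr memvZ // twisted_torus_r.
  by rewrite brZl memvZ // twisted_torus_l.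
apply/idealP; split=> [|u v uM _|v u _ uM]; first exact: subvf.
- have /memv_addP[a aN [b bT ->]] : v \in (N + T)%VS by rewrite NT memvf.
  rewrite brDr memvD // ?(Tr u b uM bT).1 // (subvP (twisted_sqr_sub t)) //.
  exact: twisted_br_r.
- have /memv_addP[a aN [b bT ->]] : v \in (N + T)%VS by rewrite NT memvf.
  rewrite brDl memvD // ?(Tr u b uM bT).2 // (subvP (twisted_sqr_sub t)) //.
  exact: twisted_br_l.
Qed.

Lemma factor_gens_free t : free (map E (factor_gens t)) /\
  (<<map E (factor_gens t)>> :&: N2 = 0)%VS.
Proof.
have [freeE _ capE] := baseE; split.
  apply: (@catl_free _ _ (map E [seq i <- iota 0 K | tau i != t])).
  by rewrite -map_cat (perm_free (perm_map E (permEl (perm_filterC _ _)))).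
apply/eqP; rewrite -subv0 -capE; apply: capvS => //;
apply: sub_span => _ /mapP[i + ->].
by rewrite mem_factor_gens => /andP[_ iK]; apply/mapP; exists i; rewrite ?mem_iota.
Qed.

Lemma size_factor_gens t : size (factor_gens t) = dim_abel br (B t).
Proof.
have [freeG capG] := factor_gens_free t.
have capM : (<<map E (factor_gens t)>> :&: sqrM t = 0)%VS.
  apply/eqP; rewrite -subv0 -capG twisted_sqr; apply: capvS => //; exact: sqr_sub.
rewrite /dim_abel -twisted_dim -twisted_sqr {1}twisted_generated.
by rewrite dimv_disjoint_sum // addnK (eqP freeG) size_map.
Qed.

(** * Bases of the factors and their products *)

Section Basis.
Variables n k : I -> nat.
Hypotheses (nE : forall t, \dim (B t) = n t) (kE : forall t, dim_abel br (B t) = k t).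

(** The generators with [x_i, E_i] = -E_i; the others are annihilated by all left
    multiplications. *)
Definition left_active i := br (x i) (E i) != 0.

Definition sorted_gens t :=
  [seq i <- factor_gens t | left_active i] ++ [seq i <- factor_gens t | ~~
    left_active i].

Definition gen_index t j := nth 0 (sorted_gens t) j.
Definition active_size t := count left_active (factor_gens t).

Lemma perm_sorted_gens t : perm_eq (sorted_gens t) (factor_gens t).
Proof. exact: permEl (perm_filterC _ _). Qed.

Lemma size_sorted_gens t : size (sorted_gens t) = k t.
Proof. by rewrite (perm_size (perm_sorted_gens t)) size_factor_gens kE. Qed.

Lemma active_size_leq t : (active_size t <= k t)%N.
Proof. by rewrite -kE -size_factor_gens count_size. Qed.

Lemma gen_index_mem t j : (j < k t)%N -> gen_index t j \in factor_gens t.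
Proof.
by move=> jk; rewrite -(perm_mem (perm_sorted_gens t)) mem_nth ?size_sorted_gens.
Qed.

Lemma gen_index_lt t j : (j < k t)%N -> (gen_index t j < K)%N.
Proof. by move/gen_index_mem; rewrite mem_factor_gens => /andP[]. Qed.

Lemma factor_of_gen_index t j : (j < k t)%N -> tau (gen_index t j) = t.
Proof. by move/gen_index_mem; rewrite mem_factor_gens => /andP[/eqP]. Qed.

Lemma gen_index_eq t j j' : (j < k t)%N -> (j' < k t)%N ->
  (gen_index t j == gen_index t j') = (j == j').
Proof.
move=> jk jk'; rewrite nth_uniq ?size_sorted_gens //.
by rewrite (perm_uniq (perm_sorted_gens t)) filter_uniq // iota_uniq.
Qed.

Lemma gen_index_neq t t' j j' : t != t' -> (j < k t)%N -> (j' < k t')%N ->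
  gen_index t j != gen_index t' j'.
Proof.
move=> tt' jk jk'; apply: contraNneq tt' => ij.
by rewrite -(factor_of_gen_index jk) ij factor_of_gen_index.
Qed.

Lemma gen_index_surj i : (i < K)%N ->
  exists2 j, (j < k (tau i))%N & gen_index (tau i) j = i.
Proof.
move=> iK; have iG : i \in sorted_gens (tau i).
  by rewrite (perm_mem (perm_sorted_gens _)) mem_factor_gens eqxx.
exists (index i (sorted_gens (tau i))); last exact: nth_index.
by rewrite -size_sorted_gens index_mem.
Qed.

Lemma left_active_gen_index t j : (j < k t)%N ->
  left_active (gen_index t j) = (j < active_size t)%N.
Proof.
move=> jk; rewrite /gen_index nth_cat size_filter -/(active_size t).
have jsz : (j < size (sorted_gens t))%N by rewrite size_sorted_gens.
case: ltnP => [jl|lj].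
  have : nth 0 [seq i <- factor_gens t | left_active i] j
      \in [seq i <- factor_gens t | left_active i] by rewrite mem_nth ?size_filter.
  by rewrite mem_filter => /andP[].
have : nth 0 [seq i <- factor_gens t | ~~ left_active i] (j - active_size t)
    \in [seq i <- factor_gens t | ~~ left_active i].
  rewrite mem_nth // -(ltn_add2l (active_size t)) subnKC //.
  by move: jsz; rewrite size_cat size_filter.
by rewrite mem_filter => /andP[/negPf].
Qed.

Definition gen_vec t j := E (gen_index t j).
Definition torus_vec t j := x (gen_index t j).

Lemma gen_vec_mem t j : (j < k t)%N -> gen_vec t j \in M t.
Proof.
by move=> jk; rewrite -{2}(factor_of_gen_index jk) gen_twisted ?gen_index_lt.
Qed.

Lemma gen_vec_span t : <<mkseq (gen_vec t) (k t)>>%VS = <<map E (factor_gens t)>>%VS.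
Proof.
apply/esym/eq_span => v; apply/mapP/mapP => [[i iG ->]|[j + ->]].
  have [iK /eqP it] : (i < K)%N /\ tau i == t.
    by move: iG; rewrite mem_factor_gens => /andP[].
  have [j] := gen_index_surj iK; rewrite it => jk <-.
  by exists j; rewrite ?mem_iota.
by rewrite mem_iota => jk; exists (gen_index t j); rewrite ?gen_index_mem.
Qed.

Lemma twisted_nilpotent t : nilpotent_alg br (M t).
Proof. exact: nilpotent_mono (twisted_sub t) nilN. Qed.

Definition word_basis t (s : seq (seq nat)) : Prop :=
  [/\ {in s, forall w, (1 < size w)%N && all (fun j => (j < k t)%N) w},
      free (map (iter_bracket br (gen_vec t)) s)
    & <<map (iter_bracket br (gen_vec t)) s>>%VS = sqrM t].

Lemma word_basis_exists : exists ws : I ->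
  seq (seq nat), forall t, word_basis t (ws t).
Proof.
suff: forall t, exists s, word_basis t s by move/fin_all_exists.
move=> t; have [|ws0 ws0P def_sqr] := bracketv_words hleib (twisted_sqr_sub t)
  (fun j => @gen_vec_mem t j) (twisted_nilpotent t).
  by rewrite gen_vec_span -twisted_generated.
have [ws [ws_sub wsfree ws_span]] := free_sub_span (iter_bracket br (gen_vec t)) ws0.
by exists ws; split=> // [w /ws_sub /ws0P|]; rewrite // ws_span.
Qed.

Variable ws : I -> seq (seq nat).
Hypothesis wsP : forall t, word_basis t (ws t).

Definition word t i := nth [::] (ws t) (i - k t).
Definition basis_vec t i := if (i < k t)%N then gen_vec t i else iter_bracket br
  (gen_vec t) (word t i).

Lemma dim_twisted_split t : n t = (k t + size (ws t))%N.
Proof.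
have [_ wsfree ws_span] := wsP t.
have -> : size (ws t) = \dim (sqrM t) by rewrite -ws_span (eqP wsfree) size_map.
rewrite -nE -kE /dim_abel -twisted_sqr subnK // -twisted_dim dimvS //.
exact: twisted_sqr_sub.
Qed.

Lemma word_mem t i : (k t <= i < n t)%N -> word t i \in ws t.
Proof.
case/andP=> ki; rewrite dim_twisted_split => iin.
by rewrite mem_nth // -(ltn_add2l (k t)) subnKC.
Qed.

Lemma basis_vec_gen t i : (i < k t)%N -> basis_vec t i = gen_vec t i.
Proof. by rewrite /basis_vec => ->. Qed.

Lemma basis_vec_word t i : (k t <= i < n t)%N ->
  basis_vec t i = iter_bracket br (gen_vec t) (word t i).
Proof. by case/andP=> ki _; rewrite /basis_vec ltnNge ki. Qed.

Lemma word_size t i : (k t <= i < n t)%N -> (1 < size (word t i))%N.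
Proof. by move/word_mem => wi; have [/(_ _ wi)/andP[]] := wsP t. Qed.

Lemma word_letters t i : (k t <= i < n t)%N -> all (fun j => (j < k t)%N) (word t i).
Proof. by move/word_mem => wi; have [/(_ _ wi)/andP[]] := wsP t. Qed.

Lemma basis_vec_iter_bracket t i : (k t <= i < n t)%N ->
  basis_vec t i = iter_bracket br (basis_vec t) (word t i).
Proof.
move=> ki; rewrite basis_vec_word //;
apply: eq_iter_bracket (word_letters ki) => j jk.
by rewrite basis_vec_gen.
Qed.

Lemma basis_vec_sqr t i : (k t <= i < n t)%N -> basis_vec t i \in sqrM t.
Proof.
move=> ki; have [_ _ <-] := wsP t.
by rewrite basis_vec_word // memv_span // map_f // word_mem.
Qed.

Lemma basis_vec_mem t i : (i < n t)%N -> basis_vec t i \in M t.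
Proof.
move=> iin; case: (ltnP i (k t)) => ki; first by rewrite basis_vec_gen ?gen_vec_mem.
by rewrite (subvP (twisted_sqr_sub t)) // basis_vec_sqr // ki.
Qed.

Lemma sqr_coef_exists : exists c : I -> L -> nat -> C,
  forall t, {in sqrM t, forall u, u = \sum_(k t <= r < n t) c t u r *: basis_vec t r}.
Proof.
suff: forall t, exists c : L -> nat -> C,
    {in sqrM t, forall u, u = \sum_(k t <= r < n t) c u r *: basis_vec t r}.
  by move/fin_all_exists.
move=> t; have [_ wsfree ws_span] := wsP t.
pose X : (size (ws t)).-tuple L :=
  Tuple (introT eqP (size_map (iter_bracket br (gen_vec t)) (ws t))).
exists (fun u r => oapp (coord X ^~ u) 0 (insub (r - k t)%N)) => u.
rewrite -ws_span -[map _ _]/(tval X) => /coord_span {1}->.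
rewrite -{1}[k t]add0n big_addn big_mkord dim_twisted_split addKn.
apply: eq_bigr => i _; rewrite addnK valK /= (nth_map [::]) //; congr (_ *: _).
rewrite basis_vec_word /word ?addnK // leq_addl /= dim_twisted_split addnC ltn_add2l.
exact: ltn_ord.
Qed.

Lemma basis_vec_span t : M t = <<mkseq (basis_vec t) (n t)>>%VS.
Proof.
apply/eqP; rewrite eqEsubv; apply/andP; split; last first.
  by apply: span_mkseq_sub => i iin; apply: basis_vec_mem.
rewrite {1}twisted_generated subv_add -gen_vec_span; apply/andP; split.
  apply: span_mkseq_sub => i ik; rewrite -basis_vec_gen // mkseq_mem_span //.
  by rewrite dim_twisted_split ltn_addr.
have [c cP] := sqr_coef_exists; apply/subvP => u /cP ->; rewrite big_nat.
by apply: memv_suml => i /andP[_ iin]; rewrite memvZ // mkseq_mem_span.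
Qed.

Lemma basis_vec_basis t : basis_of (M t) (mkseq (basis_vec t) (n t)).
Proof. by rewrite basisEdim -basis_vec_span subvv size_mkseq twisted_dim nE /=. Qed.

Lemma gen_vec_free t : free (mkseq (gen_vec t) (k t)).
Proof.
have : free (map E (sorted_gens t)).
  by rewrite (perm_free (perm_map E (perm_sorted_gens t)));
  case: (factor_gens_free t).
suff -> : map E (sorted_gens t) = mkseq (gen_vec t) (k t) by [].
apply: (@eq_from_nth _ 0); rewrite ?size_map ?size_iota ?size_sorted_gens // => i ik.
by rewrite nth_mkseq // (nth_map 0) ?size_sorted_gens.
Qed.

Lemma gen_vec_basis_mod t : basis_mod (M t) (sqrM t) (mkseq (gen_vec t) (k t)).
Proof.
split; [exact: gen_vec_free | by rewrite gen_vec_span -twisted_generated |].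
have [_ capG] := factor_gens_free t.
apply/eqP; rewrite -subv0 -capG -gen_vec_span twisted_sqr; apply: capvS => //.
exact: sqr_sub.
Qed.

(** The l-th coordinate of the weight: the degree of a basis vector in the l-th
    generator of N. *)
Definition basis_vec_weight t i l : nat :=
  if (i < k t)%N then (gen_index t i == l : nat) else count_mem l (map (gen_index
    t) (word t i)).

Let global_word t i : (k t <= i < n t)%N ->
  let w := map (gen_index t) (word t i) in
  [/\ w != [::], all (fun l => (l < K)%N) w & basis_vec t i = iter_bracket br E w].
Proof.
move=> ki; split.
- by have := word_size ki; case: (word t i).
- by rewrite all_map; apply: sub_all (word_letters ki) => j /gen_index_lt.
- by rewrite basis_vec_word // -iter_bracket_map.
Qed.

Lemma basis_vec_weight_vector t i : (i < n t)%N ->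
  weight_vector br K x (basis_vec_weight t i) (basis_vec t i).
Proof.
move=> iin; case: (ltnP i (k t)) => ki.
  rewrite basis_vec_gen //; apply: weight_vector_eq (weight_vector_gen Ex
    (gen_index_lt ki)) => l.
  by rewrite /basis_vec_weight ki.
have [|w0 wK ->] := @global_word t i; first by rewrite ki.
apply: weight_vector_eq (weight_vector_iter_bracket hleib Ex w0 wK) => l.
by rewrite /basis_vec_weight ltnNge ki.
Qed.

Lemma basis_vec_weight_same t i j : (i < n t)%N -> (j < k t)%N ->
  basis_vec_weight t i (gen_index t j) =
    if (i < k t)%N then (i == j : nat) else count_mem j (word t i).
Proof.
move=> iin jk; rewrite /basis_vec_weight; case: ltnP => ki;
first by rewrite gen_index_eq.
have /word_letters : (k t <= i < n t)%N by rewrite ki.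
elim: (word t i) => //= l w IH /andP[lk /IH ->].
by rewrite gen_index_eq.
Qed.

Lemma basis_vec_weight_neq t t' i j : t != t' -> (i < n t)%N -> (j < k t')%N ->
  basis_vec_weight t i (gen_index t' j) = 0%N.
Proof.
move=> tt' iin jk; rewrite /basis_vec_weight; case: ltnP => ki.
  by rewrite (negPf (gen_index_neq tt' ki jk)).
have /word_letters : (k t <= i < n t)%N by rewrite ki.
elim: (word t i) => //= l w IH /andP[lk /IH ->].
by rewrite (negPf (gen_index_neq tt' lk jk)).
Qed.

Lemma basis_vec_tor t t' i j : (i < n t)%N -> (j < k t')%N ->
  br (basis_vec t i) (torus_vec t' j) =
    (basis_vec_weight t i (gen_index t' j))%:R *: basis_vec t i.
Proof. by move=> iin jk; apply: basis_vec_weight_vector => //;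
apply: gen_index_lt. Qed.

Lemma torus_vec_gen t t' i j : (i < k t)%N -> (j < k t')%N ->
  br (torus_vec t' j) (gen_vec t i) =
    if (i < active_size t)%N && (gen_index t i == gen_index t' j) then - gen_vec t
      i else 0.
Proof.
move=> ik jk; rewrite -left_active_gen_index //; have iK := gen_index_lt ik.
have jK := gen_index_lt jk.
case: (boolP (left_active (gen_index t i))) => [act|]; last first.
  by rewrite /left_active negbK => /eqP /(left_gen_annr iK) ->.
rewrite /torus_vec /gen_vec (left_gen_dichotomy iK act jK) /=.
by case: eqP; rewrite ?scale1r ?scale0r ?oppr0.
Qed.

(** The torus vector kills every letter of the word, hence the word, because
    [x, [u, g]] = [[x, u], g] - [[x, g], u]. *)
Lemma torus_vec_bas_neq t t' i j : t != t' -> (i < n t)%N -> (j < k t')%N ->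
  br (torus_vec t' j) (basis_vec t i) = 0.
Proof.
move=> tt' iin jk; case: (ltnP i (k t)) => ki.
  by rewrite basis_vec_gen // torus_vec_gen // (negPf (gen_index_neq tt' ki jk))
    andbF.
have kin : (k t <= i < n t)%N by rewrite ki.
rewrite basis_vec_word //.
have := word_letters kin; have : word t i != [::] by have := word_size kin;
case: (word t i).
elim/last_ind: (word t i) => // w l IH _; rewrite all_rcons => /andP[lk wk].
have gl0 : br (torus_vec t' j) (gen_vec t l) = 0.
  by rewrite torus_vec_gen // (negPf (gen_index_neq tt' lk jk)) andbF.
have [->//|w0] := eqVneq w [::].
by rewrite iter_bracket_rcons // leibnizr // gl0 br0l subr0 IH // br0l.
Qed.

Lemma torus_vec_bas_sqr t i j : (k t <= i < n t)%N -> (j < k t)%N ->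
  br (torus_vec t j) (basis_vec t i) \in sqrM t.
Proof.
move=> ki jk; have jK := gen_index_lt jk.
have := basis_vec_sqr ki; rewrite -lmulE; apply: span_lfun_sub.
move=> w; case/allpairsP=> -[a b] /= [/vbasis_mem aM /vbasis_mem bM ->].
by rewrite lmulE leibnizr //; apply: memvB; apply: twisted_br_l.
Qed.

Lemma torus_vec_tor t t' i j : (i < k t)%N -> (j < k t')%N ->
  br (torus_vec t i) (torus_vec t' j) = 0.
Proof. by move=> /gen_index_lt iK /gen_index_lt jK; apply: xx. Qed.

Lemma torus_vec_bas_weight t i j : (i < n t)%N -> (j < k t)%N ->
  weight_vector br K x (basis_vec_weight t i) (br (torus_vec t j) (basis_vec t i)).
Proof.
move=> iin jk l lK; rewrite hleib xx ?gen_index_lt // br0l add0r.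
by rewrite basis_vec_weight_vector // brZr.
Qed.

(** The left action of the torus preserves weights, so it only mixes basis
    vectors whose words have the same letters. *)
Lemma torus_vec_bas_same (c : nat -> C) t i j : (k t <= i < n t)%N -> (j < k t)%N ->
  br (torus_vec t j) (basis_vec t i) = \sum_(k t <= r < n t) c r *: basis_vec t r ->
  br (torus_vec t j) (basis_vec t i) = \sum_(k t <= r < n t |
      [forall l : 'I_(k t), count_mem (l : nat) (word t i) == count_mem (l : nat)
        (word t r)])
    c r *: basis_vec t r.
Proof.
move=> kin jk def_u; have /andP[ki iin] := kin.
pose P r := [forall l : 'I_(k t),
  count_mem (l : nat) (word t i) == count_mem (l : nat) (word t r)].
pose v := \sum_(k t <= r < n t | P r) c r *: basis_vec t r;
set u := br _ _ in def_u *.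
suff : u = v by [].
have uv : u - v = \sum_(k t <= r < n t | ~~ P r) c r *: basis_vec t r.
  by rewrite def_u (bigID P) /= addrAC subrr add0r.
apply/eqP; rewrite -subr_eq0 -memv0.
apply: (@weight_separation C L br K x 0%VS (basis_vec_weight t i) _
  [seq c r *: basis_vec t r | r <- [seq r <- index_iota (k t) (n t) | ~~ P r]]).
- by move=> l _ y; rewrite memv0 => /eqP->; rewrite br0l mem0v.
- move=> l lK; rewrite brBl (torus_vec_bas_weight iin jk lK) -/u.
  have -> : br v (x l) = (basis_vec_weight t i l)%:R *: v;
  last by rewrite -scalerBr subrr mem0v.
  rewrite /v br_suml scaler_sumr big_nat_cond [RHS]big_nat_cond.
  apply: eq_bigr => r /andP[/andP[kr rn] Pr].
  rewrite (weight_vectorZ _ (basis_vec_weight_vector rn)) // /basis_vec_weight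
    !ltnNge kr ki /=.
  suff -> : count_mem l (map (gen_index t) (word t r))
    = count_mem l (map (gen_index t) (word t i)) by [].
  have krn : (k t <= r < n t)%N by rewrite kr.
  have /permP : perm_eq (map (gen_index t) (word t r)) (map (gen_index t) (word t i)).
    apply/perm_map/allP => m; rewrite mem_cat => /orP m_in.
    have mk : (m < k t)%N.
      by case: m_in => /(allP (word_letters _)); apply.
    by have /forallP/(_ (Ordinal mk)) := Pr; rewrite /= eq_sym.
  by apply.
- move=> _ /mapP[r + ->]; rewrite mem_filter mem_index_iota => /and3P[nP kr rn].
  exists (basis_vec_weight t r); first exact/weight_vectorZ/basis_vec_weight_vector.
  move: nP; rewrite negb_forall => /existsP[l lneq].
  exists (gen_index t l); first exact: gen_index_lt.
  by rewrite !basis_vec_weight_same // !ltnNge kr ki /= eq_sym.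
by rewrite big_map big_filter -uv subrr mem0v.
Qed.


Lemma torus_vec_kill t t' j u : t != t' -> (j < k t')%N -> u \in M t ->
  br u (torus_vec t' j) = 0 /\ br (torus_vec t' j) u = 0.
Proof.
move=> tt' jk; rewrite basis_vec_span => /span_mkseqP[c ->].
rewrite br_suml br_sumr; split; apply: big1 => i _.
  by rewrite brZl basis_vec_tor // basis_vec_weight_neq // scale0r scaler0.
by rewrite brZr torus_vec_bas_neq // scaler0.
Qed.

Definition toral t := <<mkseq (torus_vec t) (k t)>>%VS.
Definition factor t := (M t + toral t)%VS.

Lemma toral_sub t : (toral t <= T)%VS.
Proof.
by apply: span_mkseq_sub => j /gen_index_lt; apply: (mkseq_mem_span x).
Qed.

Lemma toral_br t u v : u \in toral t -> v \in T -> br u v = 0 /\ br v u = 0.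
Proof.
move=> /span_mkseqP[c ->] /span_mkseqP[d ->].
rewrite !br_suml; split; apply: big1 => i _.
  rewrite brZl br_sumr big1 ?scaler0 // => j _.
  by rewrite brZr xx ?scaler0 ?gen_index_lt.
rewrite brZl br_sumr big1 ?scaler0 // => j _.
by rewrite brZr xx ?scaler0 ?gen_index_lt.
Qed.

Lemma toral_mem i : (i < K)%N -> x i \in toral (tau i).
Proof.
move=> iK; have [j jk ij] := gen_index_surj iK.
by have := mkseq_mem_span (torus_vec (tau i)) jk; rewrite /torus_vec ij.
Qed.

Lemma toral_br_nil t u v : u \in toral t -> v \in N ->
  br u v \in M t /\ br v u \in M t.
Proof.
move=> /span_mkseqP[c ->]; rewrite -twisted_sum => /memv_sumP[w wM ->].
have idM r : {in M r, forall a b, br a b \in M r /\ br b a \in M r}.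
  by move=> a aM b; have /idealP[_ h1 h2] := twisted_ideal r; rewrite h1 ?h2 ?memvf.
rewrite br_suml br_sumr; split; apply: memv_suml => i _.
  rewrite brZl memvZ // br_sumr memv_suml // => r _.
  have [->|rt] := eqVneq r t; first by apply: (idM t _ (wM t isT) _).2.
  by rewrite (torus_vec_kill rt _ (wM r isT)).2 ?mem0v.
rewrite brZr memvZ // br_suml memv_suml // => r _.
have [->|rt] := eqVneq r t; first by apply: (idM t _ (wM t isT) _).1.
by rewrite (torus_vec_kill rt _ (wM r isT)).1 ?mem0v.
Qed.

Lemma factor_ideal t : ideal br fullv (factor t).
Proof.
have /idealP[_ M1 M2] := twisted_ideal t.
have MR : (M t <= factor t)%VS := addvSl _ _.
have mem_full v : v \in (N + T)%VS by rewrite NT memvf.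
apply/idealP; split=> [|u v uR _|v u _ uR]; first exact: subvf.
  have /memv_addP[m mM [q qQ ->]] := uR;
  have /memv_addP[a aN [b bT ->]] := mem_full v.
  rewrite brDl memvD ?(subvP MR _ (M1 _ _ mM (memvf _))) // brDr.
  rewrite (toral_br qQ bT).1 addr0; apply: subvP MR _ _.
  exact: (toral_br_nil qQ aN).1.
have /memv_addP[m mM [q qQ ->]] := uR; have /memv_addP[a aN [b bT ->]] := mem_full v.
rewrite brDr memvD ?(subvP MR _ (M2 _ _ (memvf _) mM)) // brDl.
rewrite (toral_br qQ bT).2 addr0; apply: subvP MR _ _.
exact: (toral_br_nil qQ aN).2.
Qed.

Lemma factor_cap t : (M t :&: toral t = 0)%VS.
Proof.
by apply/eqP; rewrite -subv0 -NT0; apply: capvS;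
[apply: twisted_sub | apply: toral_sub].
Qed.

Lemma factor_sum : (\sum_t factor t)%VS = fullv.
Proof.
apply/eqP; rewrite eqEsubv subvf -NT subv_add /=; apply/andP; split.
  rewrite -twisted_sum; apply/subv_sumP => t _; apply: (sumv_sup t) => //.
  exact: addvSl.
apply: span_mkseq_sub => i iK; apply: (subvP (sumv_sup (tau i) isT (subvv _))).
exact: subvP (addvSr _ _) _ (toral_mem iK).
Qed.

Lemma dim_factor_leq t : (\dim (factor t) <= n t + k t)%N.
Proof.
rewrite dimv_disjoint_sum ?factor_cap // twisted_dim nE leq_add2l.
by rewrite (leq_trans (dim_span _)) // size_mkseq.
Qed.

(** The torus vectors are independent, since they act on the generators by
    independent weights. *)
Lemma dim_torus_sum : (\sum_t k t)%N = K -> \dim {:L} = (\sum_t (n t + k t))%N.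
Proof.
move=> sumk; have [freeE _ _] := baseE.
have freex : free (mkseq x K) := torus_free Ex freeE.
rewrite -NT dimv_disjoint_sum // (eqP freex) size_mkseq big_split /= sumk; congr addn.
by rewrite -sumB (directvP dirB) /=; apply: eq_bigr.
Qed.

Lemma dim_factor_sum : (\sum_t k t)%N = K -> (\sum_t \dim (factor t) <= \dim {:L})%N.
Proof.
by move=> sumk; rewrite dim_torus_sum // leq_sum // => t _; apply: dim_factor_leq.
Qed.

Lemma gen_vec_coef_sqr t j a : (j < k t)%N -> a *: gen_vec t j \in sqrM t -> a = 0.
Proof.
move=> jk aS; have jK := gen_index_lt jk.
have aN2 : a *: gen_vec t j \in N2.
  by move: aS; rewrite twisted_sqr; apply: subvP; apply: sqr_sub.
pose c i := if i == gen_index t j then a else 0.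
have := gen_coef_eq0 baseE (c := c) _ jK; rewrite /c eqxx; apply.
rewrite (bigD1 (Ordinal jK)) //= eqxx big1 ?addr0 // => i ij.
have /negPf -> : (i : nat) != gen_index t j by move: ij; rewrite -val_eqE.
by rewrite scale0r.
Qed.

(** An element of a nilpotent ideal has no toral part: bracketing a generator
    with it again and again multiplies the generator by its eigenvalue. *)
Lemma factor_nilradical t : nilradical br (factor t) (M t).
Proof.
have MR : (M t <= factor t)%VS := addvSl _ _.
have /idealP[_ M1 M2] := twisted_ideal t.
split; [|exact: twisted_nilpotent|].
  apply/idealP; split=> // [u v uM _|v u _ uM]; last exact: M2 (memvf v) uM.
  exact: M1 uM (memvf v).
move=> J /idealP[JR _ Jl] [m Jm0]; apply/subvP => u uJ.
have /memv_addP[a aM [q /span_mkseqP[c def_q] def_u]] := subvP JR u uJ.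
suff c0 : forall j, (j < k t)%N -> c j = 0.
  by rewrite def_u def_q big1 ?addr0 // => j _; rewrite c0 ?scale0r.
move=> j jk; have gM := gen_vec_mem jk.
have gu : br (gen_vec t j) u - c j *: gen_vec t j \in sqrM t.
  have -> : br (gen_vec t j) u = br (gen_vec t j) a + c j *: gen_vec t j.
    rewrite def_u brDr def_q br_sumr (bigD1 (Ordinal jk)) //= big1 ?addr0 => [|i ij].
      by rewrite brZr Ex ?gen_index_lt // eqxx scale1r.
    rewrite brZr Ex ?gen_index_lt // gen_index_eq //.
    rewrite (_ : (j == i) = false) ?scale0r ?scaler0 //.
    by apply: contraNF ij => /eqP ji; apply/eqP/val_inj.
  by rewrite addrK memv_bracketv.
have sqr_right v : v \in sqrM t -> br v u \in sqrM t.
  move=> vS; rewrite -rmulE; apply: span_lfun_sub vS => {v} v.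
  case/allpairsP=> -[b d] /= [/vbasis_mem bM /vbasis_mem dM ->].
  by rewrite rmulE hleib memvD // memv_bracketv ?M1 ?memvf.
suff [v vJ vg] : exists2 v, v \in lower_central br J m &
    v - c j ^+ m.+1 *: gen_vec t j \in sqrM t.
  move: vJ vg; rewrite Jm0 memv0 => /eqP ->; rewrite sub0r memvN.
  by move/(gen_vec_coef_sqr jk)/eqP; rewrite expf_eq0 => /eqP.
elim: {Jm0} m => [|m [v vJ vg]].
  by exists (br (gen_vec t j) u); rewrite ?Jl ?(subvP MR) // expr1.
exists (br v u); first by rewrite memv_bracketv.
have -> : br v u - c j ^+ m.+2 *: gen_vec t j = br (v - c j ^+ m.+1 *: gen_vec t j) u
    + c j ^+ m.+1 *: (br (gen_vec t j) u - c j *: gen_vec t j).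
  by rewrite brBl brZl scalerBr scalerA -exprSr addrA subrK.
by rewrite memvD ?memvZ ?sqr_right.
Qed.

Lemma factor_solvable t : abelian_alg br (M t) -> solvable_alg br (factor t).
Proof.
move=> abM; exists 2; apply/eqP; rewrite /= -subv0 -abM.
suff sub : (bracketv br (factor t) (factor t) <= M t)%VS by apply: bracketvS.
have /idealP[_ M1 M2] := twisted_ideal t.
apply/bracketvP => u v /memv_addP[a aM [q qQ ->]] /memv_addP[b bM [r rQ ->]].
rewrite brDl; apply: memvD; first exact: M1 aM (memvf _).
rewrite brDr (toral_br qQ (subvP (toral_sub t) _ rQ)).1 addr0.
exact: M2 (memvf q) bM.
Qed.

Lemma gen_vec_notin_annr t j : t != o -> (j < active_size t)%N ->
  ~ annr br (M t) (gen_vec t j).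
Proof.
move=> to jl [gM annM]; have jk := leq_trans jl (active_size_leq t).
have jK := gen_index_lt jk; move: jl; rewrite -left_active_gen_index // => act.
case/negP: to; rewrite -(factor_of_gen_index jk) factor_of_center //.
apply: annr_gen_center => // u; rewrite -twisted_sum => /memv_sumP[w wM ->].
rewrite br_suml big1 // => r _; have [->|rt] := eqVneq r t;
first exact: annM (wM t isT).
exact: twisted_cross rt (wM r isT) gM.
Qed.

Lemma gen_vec_in_annr t j : (active_size t <= j < k t)%N ->
  annr br (M t) (gen_vec t j).
Proof.
case/andP=> lj jk; split; first exact: gen_vec_mem.
move=> u _; apply: left_gen_annr; rewrite ?gen_index_lt //.
have := left_active_gen_index jk; rewrite ltnNge lj /= => /negbT.
by rewrite negbK => /eqP.
Qed.

Lemma basis_vec_graded_basis (coef : I -> L -> nat -> C) :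
  (forall t, {in sqrM t, forall u, u =
    \sum_(k t <= r < n t) coef t u r *: basis_vec t r}) ->
  (\sum_t k t)%N = K ->
  graded_basis br o T (fun t => M t) n k active_size basis_vec torus_vec word coef.
Proof.
move=> coefP sumk.
have basE t : mkseq (basis_vec t) (k t) = mkseq (gen_vec t) (k t).
  by apply/eq_in_map => j; rewrite mem_iota => jk; apply: basis_vec_gen.
split=> /=.
- exact: basis_vec_basis.
- by move=> t; rewrite basE; apply: gen_vec_basis_mod.
- exact: active_size_leq.
- move=> t i to il; rewrite basis_vec_gen ?(leq_trans il (active_size_leq t)) //.
  exact: gen_vec_notin_annr.
- by move=> t i il; rewrite basis_vec_gen; [apply: gen_vec_in_annr | case/andP: il].
- exact: basis_vec_sqr.
- by move=> t i ki; rewrite word_size ?word_letters -?basis_vec_iter_bracket.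
- by move=> t j jk; apply/(mkseq_mem_span x)/gen_index_lt.
- move=> U yU; apply: span_mkseq_sub => i iK.
  by have [j jk <-] := gen_index_surj iK; apply: yU.
- by move=> t t' i j tt' iin jn; apply: twisted_cross tt' _ _; apply: basis_vec_mem.
- by move=> t t' i j tt' iin jk;
rewrite basis_vec_tor // basis_vec_weight_neq // scale0r.
- by move=> t t' i j tt' iin jk; rewrite torus_vec_bas_neq.
- exact: torus_vec_tor.
- by move=> t i j iin jn; apply: coefP; rewrite memv_bracketv ?basis_vec_mem.
- move=> t i j ik jk; have iin : (i < n t)%N by rewrite dim_twisted_split ltn_addr.
  rewrite basis_vec_tor // basis_vec_weight_same // ik.
  by case: eqP; rewrite ?scale1r ?scale0r.
- by move=> t i j /andP[ki iin] jk;
rewrite basis_vec_tor // basis_vec_weight_same // ltnNge ki.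
- by move=> t i j ik jk; rewrite basis_vec_gen // torus_vec_gen // gen_index_eq //
  andbC.
- move=> t i j ki jk; apply: torus_vec_bas_same => //.
  by apply: coefP; apply: torus_vec_bas_sqr.
- exact: factor_ideal.
- exact: factor_cap.
- exact: factor_nilradical.
- exact: factor_solvable.
- exact: factor_sum.
- exact: dim_factor_sum.
- exact: dim_torus_sum.
Qed.

End Basis.
End Twisted.

Lemma graded_basis_exists (n k : I -> nat) : (forall t, \dim (B t) = n t) ->
  (forall t, dim_abel br (B t) = k t) -> (\sum_t k t)%N = K ->
  exists2 phi : 'End(L), automorphism br N phi &
  exists (k1 : I -> nat) (e y : I -> nat -> L) (w : I -> nat -> seq nat)
    (coef : I -> L -> nat -> C),
    graded_basis br o T (fun t => (phi @: B t)%VS) n k k1 e y w coef.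
Proof.
move=> nE kE sumk; have [phi [phi_inj phiN2 phi_gen phiN phi_br]] := twist_exists.
have [ws wsP] := word_basis_exists phi_inj phiN2 phi_gen phiN phi_br kE.
have [coef coefP] := sqr_coef_exists phi_inj phiN2 phi_br nE kE wsP.
exists phi; first exact: twisted_automorphism.
exists active_size, (basis_vec k ws), torus_vec, (word k ws), coef.
exact: basis_vec_graded_basis.
Qed.

End Splitting.

(** * The structure theorem *)

(** A line spanned by a central element outside the square is an ideal, and so is
    any complement of it that contains the square. *)
Lemma center_sub_sqr (F : fieldType) (L : vectType F) (br : {bilinear L -> L -> L})
    (U : {vspace L}) : (bracketv br U U <= U)%VS -> ~ split_alg br U ->
  ~ abelian_alg br U -> (center br U <= bracketv br U U)%VS.
Proof.
move=> sU nsplit nabel; apply/subvP => z /centerP[zU rz lz].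
case: (boolP (z \in bracketv br U U)) => // zU2; case: nsplit.
set U2 := bracketv br U U in sU zU2; pose W := (U :\: (U2 + <[z]>))%VS.
have sub : (U2 + <[z]> <= U)%VS by rewrite subv_add sU -memvE.
have H2 : (U2 <= U2 + W)%VS := addvSl _ _.
have WU : (U2 + W <= U)%VS by rewrite subv_add sU diffvSl.
have lz_ideal : ideal br U <[z]>.
  apply/idealP; split=> [|_ u /vlineP[c ->] uU|u _ uU /vlineP[c ->]].
  - by rewrite -memvE.
  - by rewrite brZl rz // scaler0 mem0v.
  - by rewrite brZr lz // scaler0 mem0v.
exists <[z]>%VS, (U2 + W)%VS; split=> //.
- apply/idealP; split=> // u v uW vW; apply: (subvP H2).
    by rewrite memv_bracketv // (subvP WU).
  by rewrite memv_bracketv // (subvP WU).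
- by apply: contraNneq zU2 => z0; rewrite memvE z0 sub0v.
- apply/negP => /eqP W0; apply: nabel; apply/eqP; rewrite -subv0 -W0.
  exact: H2.
split.
  by rewrite addvA [(<[z]> + U2)%VS]addvC addvC addv_diff (addv_idPl sub).
apply/eqP; rewrite -subv0; apply/subvP => _ /memv_capP[/vlineP[c ->]].
case/memv_addP=> n nU [v vW def_z].
have v0 : v = 0.
  apply/eqP; rewrite -memv0 -(capv_diff U (U2 + <[z]>)) memv_cap vW /=.
  have -> : v = - n + c *: z by rewrite def_z addKr.
  by rewrite memv_add ?memvN ?memvZ ?memv_line.
move: def_z; rewrite v0 addr0 memv0 => cz.
have [->|c0] := eqVneq c 0; first by rewrite scale0r.
case/negP: zU2; rewrite -(scale1r z) -(mulVf c0) -scalerA memvZ // cz //.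
Qed.

Lemma big_option (R : Type) (idx : R) (op : Monoid.com_law idx) (T : finType)
    (F : option T -> R) :
  \big[op/idx]_(u : option T) F u = op (\big[op/idx]_t F (Some t)) (F None).
Proof.
rewrite (bigD1 None) //= Monoid.mulmC; congr (op _ _).
rewrite (reindex_omap Some id) => [|[t|] //=].
by apply: eq_bigl => t; rewrite eqxx.
Qed.

Lemma directv_of_dim (F : fieldType) (L : vectType F) (s : nat)
    (Rt : 'I_s -> {vspace L}) (RA : {vspace L}) :
  (\sum_t \dim (Rt t) + \dim RA <= \dim ((\sum_(t < s) Rt t) + RA))%N ->
  directv ((\sum_(t < s) Rt t) + RA).
Proof. by move=> le_dim; rewrite directvEgeq. Qed.

Section Assembly.
Variables (C : numClosedFieldType) (L : vectType C) (br : {bilinear L -> L -> L}).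
Hypotheses (hleib : right_leibniz br) (hsolv : solvable_alg br fullv).
Variables (N Q : {vspace L}).
Hypotheses (hN : nilradical br fullv N).
Hypotheses (hNQ : (N + Q)%VS = fullv) (hNQ0 : (N :&: Q)%VS = 0%VS).
Hypothesis hQdim : \dim Q = dim_abel br N.
Variables (s p : nat) (n k : 'I_s -> nat) (Nt : 'I_s -> {vspace L}) (A : {vspace L}).
Hypotheses (hNtideal : forall t, ideal br N (Nt t))
    (hNtnonsplit : forall t, ~ split_alg br (Nt t))
    (hNtnonabelian : forall t, ~ abelian_alg br (Nt t))
    (hn : forall t, \dim (Nt t) = n t)
    (hk : forall t, dim_abel br (Nt t) = k t)
    (hAideal : ideal br N A) (hAabelian : abelian_alg br A) (hAdim : \dim A = p)
    (hNsum : ((\sum_(t < s) Nt t) + A)%VS = N)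
    (hNdirect : directv ((\sum_(t < s) Nt t) + A))
    (hNdim : dim_abel br N = (\sum_(t < s) k t + p)%N).

Let I : finType := option 'I_s.
Let B (u : I) := if u is Some t then Nt t else A.
Let n' (u : I) := if u is Some t then n t else p.
Let k' (u : I) := if u is Some t then k t else p.

Let ideal_B u : ideal br N (B u). Proof. by case: u. Qed.
Let sumB : (\sum_u B u)%VS = N. Proof. by rewrite big_option. Qed.
Let dirB : directv (\sum_u B u).
Proof.
rewrite directvE /= sumB -hNsum; move: hNdirect; rewrite directvE /= => /eqP ->.
by rewrite big_option.
Qed.

Let dimB u : \dim (B u) = n' u. Proof. by case: u => [t|] /=. Qed.
Let abelB u : dim_abel br (B u) = k' u.
Proof. by case: u => [t|] //=; rewrite /dim_abel hAabelian dimv0 subn0. Qed.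

Let subalgB u : (bracketv br (B u) (B u) <= B u)%VS.
Proof.
have /idealP[BN h _] := ideal_B u; apply/bracketvP => a b aB bB.
by rewrite h // (subvP BN).
Qed.

Let centerB u : u != None -> (center br N :&: B u <= bracketv br (B u) (B u))%VS.
Proof.
case: u => // t _; apply: subv_trans (center_sub_sqr (subalgB (Some t))
  (@hNtnonsplit t) (@hNtnonabelian t)).
have [BN _ _] := ideal_B (Some t).
apply/subvP => z /memv_capP[/centerP[_ rz lz] zB]; apply/centerP; split=> // v vB.
  by apply: rz; apply: (subvP BN).
by apply: lz; apply: (subvP BN).
Qed.

Lemma structure_exists : exists2 phi : 'End(L), automorphism br N phi &
  exists x : nat -> L, (N + <<mkseq x (dim_abel br N)>>)%VS = fullv /\
    (N :&: <<mkseq x (dim_abel br N)>> = 0)%VS /\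
  exists (k1 : I -> nat) (e y : I -> nat -> L) (w : I -> nat -> seq nat)
    (coef : I -> L -> nat -> C),
    graded_basis br None <<mkseq x (dim_abel br N)>>%VS (fun u => (phi @: B u)%VS)
      n' k' k1 e y w coef.
Proof.
have [E [x [EN Ex xx baseE [NT NT0]]]] := torus_exists hleib hsolv hN hNQ hNQ0 hQdim.
have [idN nilN _] := hN.
have brN := br_in_nilradical hleib hsolv hN.
have [|phi phiA gb] := graded_basis_exists (o := None : I) (B :=
  B) hleib idN nilN brN EN Ex xx baseE NT NT0
  ideal_B sumB dirB hAabelian centerB dimB abelB.
  by rewrite big_option /= hNdim.
by exists phi => //; exists x; split=> //; split.
Qed.

(** Spanning follows from the decomposition into the factors, and independence
    from a count of dimensions. *)
Lemma graded_adapted_basis (phi : 'End(L)) (x : nat -> L) k1 e y w coef :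
  (N + <<mkseq x (dim_abel br N)>>)%VS = fullv ->
  (N :&: <<mkseq x (dim_abel br N)>> = 0)%VS ->
  graded_basis br None <<mkseq x (dim_abel br N)>>%VS (fun u => (phi @: B u)%VS)
      n' k' k1 e y w coef ->
  adapted_basis br p n k (fun t => k1 (Some t)) N (fun t => (phi @: Nt t)%VS)
    (phi @: A)%VS (fun t => e (Some t)) (fun t => y (Some t)) (e None) (y None)
    (fun t => w (Some t)).
Proof.
set T := <<_>>%VS => NT NT0 gb.
have eX (t : 'I_s) i : (i < n t)%N -> e (Some t) i \in
    flatten [seq mkseq (e (Some t)) (n t) ++ mkseq (y (Some t)) (k t) | t <- enum
      'I_s].
  move=> iin; apply/flattenP; exists (mkseq (e (Some t)) (n t) ++ mkseq (y (Some
    t)) (k t)).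
    by apply: map_f; rewrite mem_enum.
  by rewrite mem_cat; apply/orP; left; apply/mapP; exists i; rewrite ?mem_iota.
have yX (t : 'I_s) i : (i < k t)%N -> y (Some t) i \in
    flatten [seq mkseq (e (Some t)) (n t) ++ mkseq (y (Some t)) (k t) | t <- enum
      'I_s].
  move=> ik; apply/flattenP; exists (mkseq (e (Some t)) (n t) ++ mkseq (y (Some t))
    (k t)).
    by apply: map_f; rewrite mem_enum.
  by rewrite mem_cat; apply/orP; right; apply/mapP; exists i; rewrite ?mem_iota.
have yX' (t : 'I_s) i : (i < k t)%N -> y (Some t) i \in
    flatten [seq mkseq (y (Some t)) (k t) | t <- enum 'I_s].
  move=> ik; apply/flattenP; exists (mkseq (y (Some t)) (k t)).
    by apply: (map_f (fun t => mkseq (y (Some t)) (k t))); rewrite mem_enum.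
  by apply/mapP; exists i; rewrite ?mem_iota.
have in_mkseq (g : nat -> L) m i : (i < m)%N -> g i \in mkseq g m.
  by move=> im; apply/mapP; exists i; rewrite ?mem_iota.
split.
- rewrite basisEdim; apply/andP; split; last first.
    rewrite !size_cat !size_mkseq size_flatten /shape -map_comp sumnE big_map.
    rewrite big_enum (gb_dim gb) big_option /= leq_add2r.
    by apply: eq_leq; apply: eq_bigr => t _; rewrite /= size_cat !size_mkseq.
  rewrite -(gb_sum gb); apply/subv_sumP => u _.
  rewrite -(span_basis (gb_basis gb u)) subv_add; apply/andP; split.
    apply: sub_span => v /mapP[i + ->]; rewrite mem_iota !mem_cat => /= iin.
    by case: u iin => [t|] iin; rewrite ?eX ?in_mkseq ?orbT.
  apply: sub_span => v /mapP[i + ->]; rewrite mem_iota !mem_cat => /= iin.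
  by case: u iin => [t|] iin; rewrite ?yX ?in_mkseq ?orbT.
- by move=> t; apply: (gb_basis gb (Some t)).
- exact: (gb_basis gb None).
- by move=> t; apply: (gb_gens gb (Some t)).
- by move=> t; apply: (gb_k1 gb (Some t)).
- by move=> t i; apply: (gb_notin_annr gb (t := Some t)).
- by move=> t i; apply: (gb_in_annr gb (t := Some t)).
- by move=> t i; apply: (gb_sqr gb (t := Some t)).
- by move=> t i; apply: (gb_words gb (t := Some t)).
move=> X; suff -> : <<X>>%VS = T by [].
apply/eqP; rewrite eqEsubv; apply/andP; split.
  apply/span_subvP => v; rewrite mem_cat => /orP[/flattenP[Y]|/mapP[i + ->]].
    case/mapP=> t _ -> /mapP[i + ->]; rewrite mem_iota => ik.
    exact: (gb_tor_mem gb (t := Some t)).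
  by rewrite mem_iota => ip; apply: (gb_tor_mem gb (t := None)).
apply: (gb_tor_span gb) => -[t|] j jk; apply: memv_span; rewrite mem_cat.
  by rewrite yX'.
by rewrite in_mkseq ?orbT.
Qed.

Lemma graded_R1_table (phi : 'End(L)) T k1 e y w coef :
  graded_basis br None T (fun u => (phi @: B u)%VS) n' k' k1 e y w coef ->
  forall u v : label s, label_valid p n k u -> label_valid p n k v ->
    br (label_val (fun t => e (Some t)) (fun t => y (Some t)) (e None) (y None) u)
       (label_val (fun t => e (Some t)) (fun t => y (Some t)) (e None) (y None) v) =
    R1_table n k (fun t => k1 (Some t)) (fun t => e (Some t)) (e None)
      (fun t => w (Some t)) (fun i => ~~ (i < k1 None)%N)
      (fun t i j => coef (Some t) (br (e (Some t) i) (e (Some t) j)))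
      (fun t j i => coef (Some t) (br (y (Some t) j) (e (Some t) i))) u v.
Proof.
move=> gb.
have someN (t t' : 'I_s) : t != t' -> Some t != Some t' by [].
case=> [t i|t i|i|i] [t' j|t' j|j|j] /= ui vj.
- have [tt'|tt'] := eqVneq t t'; last exact: (gb_ee_cross gb (someN _ _ tt')).
  by rewrite -tt' in vj *; apply: (gb_ee gb (t := Some t)).
- have [tt'|tt'] /= := eqVneq t t'; last exact: (gb_ey_cross gb (someN _ _ tt')).
  rewrite -tt' in vj *; case: ltnP => ki; first exact: (gb_ey_gen gb (t := Some t)).
  by apply: (gb_ey_word gb (t := Some t)); rewrite // ki.
- exact: (gb_ee_cross gb (t := Some t) (t' := None)).
- exact: (gb_ey_cross gb (t := Some t) (t' := None)).
- have [tt'|tt'] /= := eqVneq t t'; last first.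
    by apply: (gb_ye_cross gb (t := Some t') (t' := Some t)); rewrite // eq_sym someN.
  rewrite -tt' in vj *; case: ltnP => kj; first exact: (gb_ye_gen gb (t := Some t)).
  by apply: (gb_ye_word gb (t := Some t)); rewrite // kj.
- exact: (gb_yy gb (t := Some t) (t' := Some t')).
- exact: (gb_ye_cross gb (t := None) (t' := Some t)).
- exact: (gb_yy gb (t := Some t) (t' := None)).
- exact: (gb_ee_cross gb (t := None) (t' := Some t')).
- exact: (gb_ey_cross gb (t := None) (t' := Some t')).
- by rewrite (gb_ee gb (t := None)) // big_geq.
- exact: (gb_ey_gen gb (t := None)).
- exact: (gb_ye_cross gb (t := Some t') (t' := None)).
- exact: (gb_yy gb (t := None) (t' := Some t')).
- rewrite (gb_ye_gen gb (t := None)) //; have [->|] //= := eqVneq j i.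
  by case: (i < k1 None)%N; rewrite ?sub0r ?scaleN1r ?subrr ?scale0r.
- exact: (gb_yy gb (t := None) (t' := None)).
Qed.

Theorem solvable_leibniz_structure :
  exists phi : 'End(L), automorphism br N phi /\
  exists (k1 : 'I_s -> nat) (e x : 'I_s -> nat -> L) (f y : nat -> L)
         (w : 'I_s -> nat -> seq nat),
  [/\ adapted_basis br p n k k1 N (fun t => (phi @: Nt t)%VS) (phi @: A)%VS
        e x f y w,
      exists (b : nat -> bool) (gamma beta : 'I_s -> nat -> nat -> nat -> C),
        forall u v : label s, label_valid p n k u -> label_valid p n k v ->
          br (label_val e x f y u) (label_val e x f y v) =
          R1_table n k k1 e f w b gamma beta u v
    & exists (Rt Qt : 'I_s -> {vspace L}) (RA : {vspace L}),
      [/\ (forall t, ideal br fullv (Rt t)) /\ ideal br fullv RA,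
          ((\sum_(t < s) Rt t) + RA)%VS = fullv /\
            directv ((\sum_(t < s) Rt t) + RA),
          forall t, [/\ ((phi @: Nt t) + Qt t)%VS = Rt t,
                        ((phi @: Nt t) :&: Qt t)%VS = 0%VS
                      & nilradical br (Rt t) (phi @: Nt t)%VS],
          RA = <<mkseq f p ++ mkseq y p>>%VS
        & solvable_alg br RA /\ nilradical br RA (phi @: A)%VS]].
Proof.
have [phi phiA [x [NT [NT0 [k1 [e [y [w [coef gb]]]]]]]]] := structure_exists.
exists phi; split=> //.
exists (fun t => k1 (Some t)), (fun t => e (Some t)), (fun t => y (Some t)), (e None),
  (y None), (fun t => w (Some t)); split.
- exact: graded_adapted_basis gb.
- exists (fun i => ~~ (i < k1 None)%N).
  exists (fun t i j => coef (Some t) (br (e (Some t) i) (e (Some t) j))).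
  exists (fun t j i => coef (Some t) (br (y (Some t) j) (e (Some t) i))).
  exact: graded_R1_table gb.
pose R (u : I) := ((phi @: B u) + <<mkseq (y u) (k' u)>>)%VS.
have sumR : ((\sum_(t < s) R (Some t)) + R None)%VS = fullv.
  by have := gb_sum gb; rewrite big_option.
exists (fun t => R (Some t)), (fun t => <<mkseq (y (Some t)) (k t)>>%VS), (R None).
split.
- split=> [t|]; [exact: (gb_ideal gb (Some t)) | exact: (gb_ideal gb None)].
- split=> //; apply: directv_of_dim; rewrite sumR.
  by have := gb_dim_sum gb; rewrite big_option.
- move=> t; split; [by [] | exact: (gb_cap gb (Some t)) |].
  exact: (gb_nilradical gb (Some t)).
- by rewrite span_cat (span_basis (gb_basis gb None)).
have abelM : abelian_alg br (phi @: A)%VS.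
  have [_ genM capM] := gb_gens gb None.
  have sqrM : (bracketv br (phi @: A) (phi @: A) <= phi @: A)%VS by rewrite -[X in
    (_ <= X)%VS]genM addvSr.
  apply/eqP; rewrite -subv0 -capM subv_cap subvv andbT.
  by rewrite (span_basis (gb_basis gb None)).
by split; [apply: (gb_solvable gb (t := None)) | apply: (gb_nilradical gb None)].
Qed.

End Assembly.

Theorem theorem4p5 (R : realType) (L : vectType R[i])
    (br : {bilinear L -> L -> L}) (hleib : right_leibniz br)
    (hsolv : solvable_alg br fullv)
    (N Q : {vspace L}) (hN : nilradical br fullv N)
    (hNQ : (N + Q)%VS = fullv) (hNQ0 : (N :&: Q)%VS = 0%VS)
    (s p : nat) (n k : 'I_s -> nat)
    (Nt : 'I_s -> {vspace L}) (A : {vspace L})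
    (hNtideal : forall t, ideal br N (Nt t))
    (hNtnonsplit : forall t, ~ split_alg br (Nt t))
    (hNtnonabelian : forall t, ~ abelian_alg br (Nt t))
    (hn : forall t, \dim (Nt t) = n t)
    (hk : forall t, dim_abel br (Nt t) = k t)
    (hAideal : ideal br N A) (hAabelian : abelian_alg br A) (hAdim : \dim A = p)
    (hNsum : ((\sum_(t < s) Nt t) + A)%VS = N)
    (hNdirect : directv ((\sum_(t < s) Nt t) + A))
    (hQdim : \dim Q = dim_abel br N)
    (hNdim : dim_abel br N = (\sum_(t < s) k t + p)%N) :
  exists phi : 'End(L), automorphism br N phi /\
  exists (k1 : 'I_s -> nat) (e x : 'I_s -> nat -> L) (f y : nat -> L)
         (w : 'I_s -> nat -> seq nat),
  [/\ adapted_basis br p n k k1 N (fun t => (phi @: Nt t)%VS) (phi @: A)%VS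
        e x f y w,
      exists (b : nat -> bool) (gamma beta : 'I_s -> nat -> nat -> nat -> R[i]),
        forall u v : label s, label_valid p n k u -> label_valid p n k v ->
          br (label_val e x f y u) (label_val e x f y v) =
          R1_table n k k1 e f w b gamma beta u v
    & exists (Rt Qt : 'I_s -> {vspace L}) (RA : {vspace L}),
      [/\ (forall t, ideal br fullv (Rt t)) /\ ideal br fullv RA,
          ((\sum_(t < s) Rt t) + RA)%VS = fullv /\
            directv ((\sum_(t < s) Rt t) + RA),
          forall t, [/\ ((phi @: Nt t) + Qt t)%VS = Rt t,
                        ((phi @: Nt t) :&: Qt t)%VS = 0%VS
                      & nilradical br (Rt t) (phi @: Nt t)%VS],
          RA = <<mkseq f p ++ mkseq y p>>%VS
        & solvable_alg br RA /\ nilradical br RA (phi @: A)%VS]].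
Proof.
exact: (@solvable_leibniz_structure R[i] L br hleib hsolv N Q hN hNQ hNQ0 hQdim s p
  n k
  Nt A hNtideal hNtnonsplit hNtnonabelian hn hk hAideal hAabelian hAdim hNsum
  hNdirect hNdim).
Qed.
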